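(* Let $G$ be a connected twin-free line graph of order at least $4$, and let $H$ be a connected graph with $L(H)=G$ (up to isomorphism). Let $G\in\mathrm{ORTH}[h,2,t]$ for some integers $h\geq 3$ and $t\geq 1$. If $H'$ is a subgraph of $H$ of order $n(H')\geq 2$, then there is a set $X$ of vertices of $H'$ and a partition of $V(H')$ into two sets $A$ and $B$ such that (i) $\frac{1}{h}n(H')\leq |A|,|B|\leq \frac{h-1}{h}n(H')$, (ii) $|X|\leq \max\{ 1,(h-1)^{t-2}\}$, and (iii) $H'$ contains no edge between $A\setminus X$ and $B\setminus X$. Furthermore, given $H'$, such sets $X$, $A$, and $B$ can be found in polynomial time.
   Context: Graphs are finite and simple; $n(H')$ is the number of vertices of $H'$. $L(H)$ is the line graph of $H$. Two distinct vertices $u,v$ are twins if $N[u]=N[v]$; a graph is twin-free if it has no twins. For positive integers $h,s,t$, $\mathrm{ORTH}[h,s,t]$ is the class of graphs $G$ having a pair $(T,\mathcal{S})$, where $T$ is a tree of maximum degree at most $h$ and $\mathcal{S}=(S_u)_{u\in V(G)}$ is a collection of subtrees of $T$ of maximum degree at most $s$, one per vertex of $G$, such that every leaf of each $S_u$ is a leaf of $T$, and for all distinct $u,v\in V(G)$ the following are equivalent: (i) $u,v$ adjacent; (ii) $S_u,S_v$ have at least $t$ common vertices; (iii) $S_u,S_v$ share a leaf of $T$. *)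

(* Defs.v *)
From HB Require Import structures.
From mathcomp Require Import all_boot all_order all_algebra.

Set Implicit Arguments.
Unset Strict Implicit.
Unset Printing Implicit Defensive.

Record sgraph := SGraph {
  vertex :> finType;
  adj : rel vertex;
  adj_sym : symmetric adj;
  adj_irr : irreflexive adj }.

Arguments adj {s}.

Section Graphs.
Variable G : sgraph.

Definition nbhd (u : G) : {set G} := [set v | adj u v].
Definition cnbhd (u : G) : {set G} := u |: nbhd u.
Definition degree (u : G) : nat := #|nbhd u|.
Definition leaf (u : G) : bool := degree u == 1.
Definition max_degree_le (d : nat) : Prop := forall u : G, degree u <= d.

Definition twins (u v : G) : Prop := u <> v /\ cnbhd u = cnbhd v.
Definition twin_free : Prop := forall u v : G, ~ twins u v.

Definition connected : Prop := 0 < #|G| /\ forall u v : G, connect adj u v.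

(* [cycle] counts a single edge traversed back and forth as a cycle of
   length 2; graph-theoretic cycles have length at least 3. *)
Definition acyclic : Prop := forall c : seq G, 2 < size c -> ~ ucycle adj c.
Definition is_tree : Prop := connected /\ acyclic.

Definition edges : {set {set G}} :=
  [set e : {set G} | [exists u, exists v, adj u v && (e == [set u; v])]].

End Graphs.

Definition iso (G H : sgraph) : Prop :=
  exists f : G -> H, bijective f /\ forall u v, adj (f u) (f v) = adj u v.

Section LineGraph.
Variable H : sgraph.

Definition line_vertex := {e : {set H} | e \in edges H}.
Definition line_adj : rel line_vertex :=
  fun e f => (e != f) && (val e :&: val f != set0).

Lemma line_adj_sym : symmetric line_adj.
Proof. by move=> e f; rewrite /line_adj eq_sym setIC. Qed.

Lemma line_adj_irr : irreflexive line_adj.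
Proof. by move=> e; rewrite /line_adj eqxx. Qed.

Definition line_graph : sgraph := SGraph line_adj_sym line_adj_irr.
End LineGraph.

(* Subgraphs are not required to be induced. *)
Record subgraph (H : sgraph) := Subgraph {
  sub_verts : {set H};
  sub_edge : rel H;
  sub_edge_sym : symmetric sub_edge;
  sub_edgeP : forall u v, sub_edge u v ->
    [&& u \in sub_verts, v \in sub_verts & adj u v] }.

Section SubgraphGraph.
Variables (H : sgraph) (K : subgraph H).

Definition sub_vertex := {u : H | u \in sub_verts K}.
Definition sub_adj : rel sub_vertex := fun u v => sub_edge K (val u) (val v).

Lemma sub_adj_sym : symmetric sub_adj.
Proof. by move=> u v; apply: sub_edge_sym. Qed.

Lemma sub_adj_irr : irreflexive sub_adj.
Proof.
move=> u; apply/negP => /sub_edgeP /and3P[_ _].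
by rewrite adj_irr.
Qed.

Definition sub_graph : sgraph := SGraph sub_adj_sym sub_adj_irr.
End SubgraphGraph.

Coercion sub_graph : subgraph >-> sgraph.

Definition ORTH (h s t : nat) (G : sgraph) : Prop :=
  exists (T : sgraph) (S : G -> subgraph T),
    [/\ is_tree T /\ max_degree_le T h,
        forall u, is_tree (S u) /\ max_degree_le (S u) s,
        forall u (x : S u), leaf x -> leaf (val x)
      & forall u v, u <> v ->
          [<-> adj u v;
               t <= #|sub_verts (S u) :&: sub_verts (S v)|;
               exists x : T,
                 [/\ leaf x, x \in sub_verts (S u) & x \in sub_verts (S v)]]].

Section Separation.
Import GRing.Theory Num.Theory.
Local Open Scope ring_scope.

(* For [t = 1] the exponent is [-1]. *)
Definition balanced_separation (h t : nat) (K : sgraph) (X A B : {set K}) :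
    Prop :=
  let n : rat := #|K|%:R in
  [/\ A :|: B = [set: K] /\ A :&: B = set0,
      h%:R^-1 * n <= #|A|%:R <= (h%:R - 1) / h%:R * n,
      h%:R^-1 * n <= #|B|%:R <= (h%:R - 1) / h%:R * n,
      #|X|%:R <= Num.max 1 ((h%:R - 1) ^ (t%:Z - 2) : rat)
    & forall x y, x \in A :\: X -> y \in B :\: X -> ~ adj x y].

End Separation.

(* Random access machine with addition and truncated subtraction as its only
   arithmetic, under the uniform cost measure.  As there is no multiplication,
   the bit length of the numbers grows by O(1) per step, so that polynomial
   time on this machine coincides with polynomial time on Turing machines. *)
Definition memory := nat -> nat.

Inductive expr :=
| Const of nat
| Fetch of expr
| Plus of expr & expr
| Minus of expr & expr.

Inductive prog :=
| Skip
| Store of expr & expr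
| Then of prog & prog
| If of expr & prog & prog
| While of expr & prog.

Fixpoint eval (m : memory) (e : expr) : nat :=
  match e with
  | Const k => k
  | Fetch a => m (eval m a)
  | Plus a b => eval m a + eval m b
  | Minus a b => eval m a - eval m b
  end.

Fixpoint cost (e : expr) : nat :=
  match e with
  | Const _ => 1
  | Fetch a => (cost a).+1
  | Plus a b | Minus a b => (cost a + cost b).+1
  end.

Definition update (m : memory) (a k : nat) : memory :=
  fun b => if b == a then k else m b.

(* [run P m T m']: started in memory [m], the program [P] halts after [T]
   steps in memory [m']. *)
Inductive run : prog -> memory -> nat -> memory -> Prop :=
| RunSkip m : run Skip m 1 m
| RunStore a e m :
    run (Store a e) m (cost a + cost e).+1 (update m (eval m a) (eval m e))
| RunThen P Q m1 T1 m2 T2 m3 :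
    run P m1 T1 m2 -> run Q m2 T2 m3 -> run (Then P Q) m1 (T1 + T2) m3
| RunIfTrue e P Q m T m' :
    eval m e != 0 -> run P m T m' -> run (If e P Q) m (cost e + T).+1 m'
| RunIfFalse e P Q m T m' :
    eval m e = 0 -> run Q m T m' -> run (If e P Q) m (cost e + T).+1 m'
| RunWhileTrue e P m1 T1 m2 T2 m3 :
    eval m1 e != 0 -> run P m1 T1 m2 -> run (While e P) m2 T2 m3 ->
    run (While e P) m1 (cost e + T1 + T2).+1 m3
| RunWhileFalse e P m :
    eval m e = 0 -> run (While e P) m (cost e).+1 m.

Section Encoding.
Variables (K : sgraph) (lab : 'I_#|K| -> K).

(* Cell 0 holds the order of the graph; it is followed by the adjacency matrix
   with respect to the vertex numbering [lab], row by row. *)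
Definition encodes (m : memory) : Prop :=
  [/\ m 0 = #|K|,
      forall i j : 'I_#|K|,
        m (i * #|K| + j).+1 = nat_of_bool (adj (lab i) (lab j))
    & forall a, #|K| * #|K| < a -> m a = 0].

(* The set whose characteristic vector is the [k]-th block of [#|K|] cells. *)
Definition read_set (m : memory) (k : nat) : {set K} :=
  [set lab i | i : 'I_#|K| & m (k * #|K| + i) != 0].

End Encoding.

(* Some polynomial-time program computes, from any encoding of a graph [K] in
   the class [C], sets [X], [A], [B] of vertices of [K] satisfying [R]. *)
Definition poly_time_find (C : sgraph -> Prop)
    (R : forall K : sgraph, {set K} -> {set K} -> {set K} -> Prop) : Prop :=
  exists (P : prog) (p : {poly nat}),
    forall K : sgraph, C K ->
    forall lab : 'I_#|K| -> K, bijective lab ->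
    forall m : memory, encodes lab m ->
    exists (T : nat) (m' : memory),
      [/\ run P m T m', T <= p.[#|K|]%R
        & R K (read_set lab m' 0) (read_set lab m' 1) (read_set lab m' 2)].

(* Main.v *)
(* A vertex of [G] is an edge of [H], and its tree is a path between leaves of
   the host tree [T].  Twin-freeness makes the sets of end leaves distinct, so
   they form an edge labelling of [H] that preserves and reflects incidence.  As
   in Whitney's theorem on line graphs, such a labelling comes from a map
   [phi] from [V(H)] to the leaves of [T], except that for some graphs of order
   four two opposite edges must first be exchanged; [phi] identifies at most two
   vertices.  An edge [xy] of [T] splits the leaves carrying [H'] in a balanced
   way.  Every edge of [H'] across the split has a tree through [xy]; sorting
   these trees by the vertex they reach [t - 2] steps further leaves at most
   [(h - 1) ^ (t - 2)] classes.  Two trees of one class share [t] vertices or a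
   leaf, so the edges of a class meet pairwise and, being bipartite, form a
   star, whose centre goes into [X].

   For the algorithm the tree is not needed.  All [X] of bounded size are tried;
   if the components of [H' - X] are small enough for a balanced split to exist,
   then either one component alone, or a greedy union of components each smaller
   than [n / h], has a size between [n / h] and [(h - 1) n / h]. *)
Require Import Defs.
From HB Require Import structures.
From mathcomp Require Import all_boot all_order all_algebra.
From mathcomp Require Import zify.

Set Implicit Arguments.
Unset Strict Implicit.
Unset Printing Implicit Defensive.

(** * Cutting a tree at an edge *)

(** The record [tree_rep] joins the two halves of the combinatorial proof. Its condition [rep_meet]
    goes from meeting trees to meeting edges only, which allows the edge [uv] to borrow the tree of
    another edge when two opposite edges are exchanged. The exponent [t - 2] counts the vertices
    that a common path still lacks when both ends of the cut edge are known. A path that reaches a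
    leaf of the host tree stops early, since a common leaf serves as well as [t] common vertices.
    The algorithm rests on a converse: a component left by any separator containing [X] is a single
    vertex or lies within [A] or within [B], so the mere existence of a balanced split bounds all
    components. As the bound on the size of [X] depends on [h] and [t] only, exhaustive search is
    polynomial. *)

Lemma connect_cut (T : finType) (e : rel T) (D : pred T) (a b : T) :
  connect e a b -> D a -> ~~ D b -> exists x y, [/\ e x y, D x & ~~ D y].
Proof.
move=> /connectP[p]; elim: p a => [|c p IHp] a /=.
  by move=> _ -> ->.
case/andP=> eac pcp lb Da nDb; case Dc: (D c); first exact: IHp pcp lb Dc nDb.
by exists a, c; rewrite Dc.
Qed.

Lemma set2_eq (V : finType) (a b x y : V) :
  ([set a; b] == [set x; y]) =
  ((a == x) && (b == y)) || ((a == y) && (b == x)).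
Proof.
apply/eqP/idP => [/setP E|]; last first.
  by case/orP=> /andP[/eqP-> /eqP->] //; rewrite setUC.
have := E a; rewrite !inE eqxx => /esym/orP[] /eqP ax;
  have := E b; rewrite !inE eqxx orbT => /esym/orP[] /eqP bx;
  have := E x; have := E y; subst; rewrite !inE !eqxx ?orbT ?orbb //=.
- by move=> /eqP->; rewrite eqxx.
- by move=> _ /eqP->; rewrite eqxx.
Qed.

Section Tree.
Variable T : sgraph.
Hypothesis treeT : is_tree T.
Implicit Types x y z : T.

(** [side x y] is the component of [y] once the edge [xy] is deleted. Unordered pairs are compared,
    so the edge is blocked in both directions. *)
Definition cut_adj x y : rel T :=
  fun a b => adj a b && ([set a; b] != [set x; y]).
Definition side x y : {set T} := [set z | connect (cut_adj x y) y z].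

Lemma side_head x y : y \in side x y.
Proof. by rewrite inE connect0. Qed.

(** A path from [y] to [x] avoiding the edge [xy] closes up with this edge to a cycle. It has at
    least three vertices, because the path is neither empty nor the edge itself. *)
Lemma side_tail x y : adj x y -> x \notin side x y.
Proof.
move=> axy; rewrite inE; apply/negP => /connectP[p].
case/shortenP=> q pq uq _ lq.
have neq : y != x by apply: contraTneq axy => ->; rewrite adj_irr.
apply: (treeT.2 (y :: q)).
  case: q pq uq lq => [_ _ /= E|c [|//]]; first by rewrite E eqxx in neq.
  by rewrite /= andbT => /andP[_ nc] _ E; rewrite -E setUC eqxx in nc.
apply/andP; split => //=; rewrite rcons_path -lq axy andbT.
by apply: sub_path pq => a b /andP[].
Qed.

(** Any other edge into the side survives the cut and would pull its tail into the side. *)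
Lemma side_crossing x y a b :
  adj x y -> adj a b -> a \notin side x y -> b \in side x y -> a = x /\ b = y.
Proof.
move=> axy aab na bs.
have /negbNE: ~~ ([set a; b] != [set x; y]).
  apply: contra na => ne; move: bs; rewrite !inE => cb.
  apply: connect_trans cb (connect1 _).
  by rewrite /cut_adj adj_sym aab setUC.
rewrite set2_eq => /orP[] /andP[/eqP ea /eqP eb] //.
by move: na; rewrite ea side_head.
Qed.

(** A simple path from [y] never returns to [y], so after its first edge [yw] it also avoids that
    edge. *)
Lemma side_step x y z :
  z \in side x y -> z != y -> exists2 w, w \in nbhd y :\ x & z \in side y w.
Proof.
rewrite inE => /connectP[p]; case/shortenP=> q pq uq _ ->.
case: q pq uq => [|w q] /=; first by rewrite eqxx.
case/andP=> /andP[ayw ne] pq /andP[yq uq] _.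
exists w; first by rewrite !inE ayw andbT; apply: contraNneq ne => ->; rewrite setUC.
rewrite inE; apply/connectP; exists q => //.
have: forall c, path (cut_adj x y) c q -> y \notin c :: q ->
    path (cut_adj y w) c q; last by move=> H; apply: H.
elim: q {pq yq uq} => //= d q IHq c /andP[/andP[acd _] pq].
rewrite !inE !negb_or => /and3P[nc nd nq].
rewrite IHq ?inE ?negb_or ?nd // andbT /cut_adj acd set2_eq.
by rewrite (eq_sym c) (negPf nc) andFb (eq_sym d) (negPf nd) andbF.
Qed.

(** The vertex [y] is lost. A path within [side y z] that left [side x y] would have to cross the
    edge [xy] at [y], which does not lie in [side y z]. *)
Lemma side_proper x y z :
  adj x y -> adj y z -> z != x -> side y z \proper side x y.
Proof.
move=> axy ayz zx; apply/properP; split; last first.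
  by exists y; rewrite ?side_head // side_tail.
apply/subsetP => u us; apply/negbNE/negP => nu.
have cz : connect (cut_adj y z) z u by rewrite inE in us.
pose D := [pred w in side x y | w \in side y z].
have Dz : D z.
  rewrite !inE connect0 andbT; apply: connect1.
  rewrite /cut_adj ayz set2_eq (negPf zx) andbF orbF negb_and.
  by apply/orP; left; apply: contraTneq axy => ->; rewrite adj_irr.
have nDu : ~~ D u by rewrite /= (negPf nu).
have [a [b [/andP[aab nab] /andP[/= ax ay] nDb]]] := connect_cut cz Dz nDu.
have bs : b \in side y z.
  move: ay; rewrite !inE => ay; apply: connect_trans ay (connect1 _).
  by rewrite /cut_adj aab.
move: nDb; rewrite /= bs andbT => nb.
have aba : adj b a by rewrite adj_sym.
have [eb ea] := side_crossing axy aba nb ax.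
by move: ay; rewrite ea (negPf (side_tail ayz)).
Qed.

Lemma sides_cover x y z : adj x y -> (z \in side x y) || (z \in side y x).
Proof.
move=> axy; case zs: (z \in side x y) => //=; apply/negbNE/negP => nz.
have [u [v [auv]]] := connect_cut (D := [pred w | (w \in side x y) || (w \in side y x)])
  (treeT.1.2 y z) (introT orP (or_introl (side_head x y))) (introT norP (conj (negbT zs) nz)).
rewrite /= negb_or => us /andP[vx vy].
have avu : adj v u by rewrite adj_sym.
have ayx : adj y x by rewrite adj_sym.
case/orP: us => us.
  by have [ev _] := side_crossing axy avu vx us; rewrite ev side_head in vy.
by have [ev _] := side_crossing ayx avu vy us; rewrite ev side_head in vx.
Qed.

(** Otherwise the initial segment up to [z] and the edge [xz] form a cycle, of length at least three
    since [z] is not [y]. *)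
Lemma cycle_free_extension x y z (p : seq T) :
  path adj x (y :: p) -> uniq (x :: y :: p) -> adj x z -> z != y ->
  z \notin x :: y :: p.
Proof.
move=> pp up axz zy; apply/negP; rewrite !inE (negPf zy) /=.
case/orP=> [/eqP E|zp]; first by rewrite E adj_irr in axz.
case/splitPr: zp pp up => p1 p2 /= /andP[axy]; rewrite cat_path => /andP[pp1 /=].
case/andP=> lz _ /and3P[]; rewrite !inE !mem_cat !inE !negb_or.
case/and4P=> xy xp1 xz xp2 /and3P[yp1 yz yp2].
rewrite cat_uniq /= => /and3P[u1 /norP[zp1 _] _].
apply: (treeT.2 (x :: y :: rcons p1 z)).
  by rewrite /= size_rcons.
apply/andP; split=> /=.
  by rewrite axy rcons_path last_rcons rcons_path pp1 lz adj_sym axz.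
rewrite ?inE !mem_rcons !inE !negb_or xy xz xp1 yz yp1 /=.
by rewrite rcons_uniq zp1 u1.
Qed.

End Tree.

(** * Balanced edges of a tree with weighted leaves *)

Section BalancedEdge.
Variables (T : sgraph) (h : nat).
Hypothesis treeT : is_tree T.
Hypothesis degT : max_degree_le T h.
Hypothesis h_ge3 : 3 <= h.
Variables (K : finType) (phi : K -> T).
Hypothesis phi_leaf : forall u, leaf (phi u).
Hypothesis phi_fibre : forall x, #|[set u | phi u == x]| <= 2.
Hypothesis K_ge3 : 3 <= #|K|.

Let weight x y := #|[set u | phi u \in side x y]|.
Let coweight x y := #|[set u | phi u \notin side x y]|.

Lemma weight_coweight x y : weight x y + coweight x y = #|K|.
Proof.
rewrite /weight /coweight -(cardsC [set u | phi u \in side x y]); congr (_ + _).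
by apply: eq_card => u; rewrite !inE.
Qed.

Lemma leaf_side x y : adj x y -> leaf y -> weight x y <= 2.
Proof.
move=> axy ly; apply: leq_trans (phi_fibre y); apply: subset_leq_card.
apply/subsetP => u; rewrite !inE -/(side x y) => us.
apply/negbNE/negP => ne; have [|w] := side_step (x := x) (y := y) (z := phi u) _ ne.
  by rewrite inE.
rewrite !inE => /andP[wx ayw] _; move: ly; rewrite /leaf /degree => /eqP ly.
have: [set x; w] \subset nbhd y.
  by apply/subsetP => v; rewrite !inE => /orP[/eqP->|/eqP->]; rewrite // adj_sym.
by move/subset_leq_card; rewrite cards2 eq_sym wx ly.
Qed.

(** All weight sits on leaves, so none is at [y] itself. *)
Lemma weight_split x y : adj x y -> ~~ leaf y ->
  weight x y <= \sum_(z in nbhd y :\ x) weight y z.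
Proof.
move=> axy nl.
have /subset_leq_card sub: [set u | phi u \in side x y] \subset
    \bigcup_(z in nbhd y :\ x) [set u | phi u \in side y z].
  apply/subsetP => u; rewrite inE => us.
  have ne : phi u != y by apply: contraNneq nl => <-.
  have [w wn ws] := side_step us ne.
  by apply/bigcupP; exists w => //; rewrite in_set; exact: ws.
apply: leq_trans sub _.
elim/big_rec2: _ => [|z m D _ IH]; first by rewrite cards0.
rewrite (leq_trans (leq_card_setU _ _)) // leq_add2l.
exact: IH.
Qed.

(** An edge [xy] with at least half the weight on the side of [y] is pushed forward. If less than
    [n / h] lies behind it, the at most [h - 1] other edges at [y] share more than [(h - 1) n / h],
    so one of them carries more than [n / h]. Either that edge is balanced, or it carries half the
    weight again and has a smaller side. *)
Lemma balanced_edge :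
  exists x y, [/\ adj x y, #|K| <= h * weight x y & #|K| <= h * coweight x y].
Proof.
have /card_gt0P[u0 _] : 0 < #|K| by apply: leq_trans K_ge3.
move: K_ge3; set n := #|K| => n_ge3.
have [y0 ady0] : exists y, adj (phi u0) y.
  have: 0 < #|nbhd (phi u0)| by move: (phi_leaf u0); rewrite /leaf /degree => /eqP->.
  by case/card_gt0P=> y; rewrite inE; exists y.
have [x1 [y1 [a1 w1]]] : exists x y, adj x y /\ n <= 2 * weight x y.
  case: (leqP n (2 * weight (phi u0) y0)) => w0; first by exists (phi u0), y0.
  exists y0, (phi u0); rewrite adj_sym; split => //.
  have: coweight (phi u0) y0 <= weight y0 (phi u0).
    apply: subset_leq_card; apply/subsetP => u; rewrite [in X in X -> _]inE => nu.
    have := sides_cover treeT (phi u) ady0; rewrite (negPf nu) /= => s.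
    by rewrite inE.
  have := weight_coweight (phi u0) y0; rewrite -/n; lia.
have [N] := ubnP #|side x1 y1|; elim: N x1 y1 a1 w1 => // N IH x y axy wxy szN.
have wc := weight_coweight x y; rewrite -/n in wc.
case: (leqP n (h * coweight x y)) => big.
  exists x, y; split => //; apply: leq_trans wxy _; rewrite leq_mul2r; lia.
(* Impossible at a leaf: at most two vertices lie ahead, and the [n - 2] others are at least [n / 3]
   because [n >= 3]. *)
case ly: (leaf y).
  have := leaf_side axy ly => w2.
  have: 3 * coweight x y <= h * coweight x y by rewrite leq_mul2r h_ge3 orbT.
  lia.
have ws := weight_split axy (negbT ly).
have [z zn zw] : exists2 z, z \in nbhd y :\ x & n < h * weight y z.
  apply/exists_inP; apply/negbNE/negP => /exists_inPn none.
  have sm : \sum_(z in nbhd y :\ x) h * weight y z <= \sum_(z in nbhd y :\ x) n.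
    by apply: leq_sum => z zn; rewrite leqNgt; apply: none.
  move: sm; rewrite sum_nat_const -big_distrr /= => sm.
  have dc : #|nbhd y :\ x| <= h.-1.
    have := degT y; rewrite /degree (cardsD1 x) inE adj_sym axy /=; lia.
  have h1 : h * weight x y <= h * \sum_(z in nbhd y :\ x) weight y z.
    by rewrite leq_mul2l ws orbT.
  have h2 : #|nbhd y :\ x| * n <= h.-1 * n by rewrite leq_mul2r dc orbT.
  have h3 : h.-1 * n + n = h * n by rewrite -mulSnr prednK //; lia.
  have h4 : h * weight x y + h * coweight x y = h * n by rewrite -mulnDr wc.
  lia.
move: zn; rewrite !inE => /andP[zx ayz].
case: (leqP n (2 * weight y z)) => wz.
  apply: (IH y z) => //.
  have := proper_card (side_proper treeT axy ayz zx); lia.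
have wcz := weight_coweight y z; rewrite -/n in wcz.
exists y, z; split => //; first lia.
have: 3 * coweight y z <= h * coweight y z by rewrite leq_mul2r h_ge3 orbT.
lia.
Qed.

End BalancedEdge.

(** * Separators from tree representations *)

Definition shares (V : eqType) (u v u' v' : V) : bool :=
  [|| u == u', u == v', v == u' | v == v'].

(** [rep_cut] is connectedness of the tree of an edge, phrased as a crossing of every cut between
    the two labels; [rep_through] says that this tree ends only at leaves of [T]. All clauses are
    universal in vertices and edges, so they pass to subgraphs. *)
Record tree_rep (t : nat) (K T : sgraph) (phi : K -> T)
    (R : K -> K -> subgraph T) : Prop := TreeRep {
  rep_leaf : forall u, leaf (phi u);
  rep_fibre : forall x, #|[set u | phi u == x]| <= 2;
  rep_cut : forall u v (D : pred T), adj u v -> D (phi u) -> ~~ D (phi v) ->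
    exists x y, [/\ sub_edge (R u v) x y, D x & ~~ D y];
  rep_through : forall u v x y, adj u v -> sub_edge (R u v) x y -> ~~ leaf x ->
    exists2 z, z != y & sub_edge (R u v) x z;
  rep_meet : forall u v u' v', adj u v -> adj u' v' ->
    t <= #|sub_verts (R u v) :&: sub_verts (R u' v')| \/
      (exists x, [/\ leaf x, x \in sub_verts (R u v) & x \in sub_verts (R u' v')]) ->
    shares u v u' v' }.

(** Free of division: the upper bound on each side is the lower bound on the other. *)
Definition separation (h M : nat) (K : sgraph) (X A B : {set K}) : Prop :=
  [/\ A :|: B = [set: K], A :&: B = set0,
      #|K| <= h * #|A| /\ #|K| <= h * #|B|,
      #|X| <= M
    & forall x y, x \in A :\: X -> y \in B :\: X -> ~ adj x y].

(** Edges directed across [D] meet only in equal coordinates. Two of them that differ in the first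
    end agree in the second, and a third one avoiding that second end would share its first end with
    both. The centre of an empty family is [w0]. *)
Lemma bipartite_star (V : finType) (D : pred V) (F : {set V * V}) (w0 : V) :
  (forall e, e \in F -> D e.1 /\ ~~ D e.2) ->
  (forall e f, e \in F -> f \in F -> shares e.1 e.2 f.1 f.2) ->
  exists w, forall e, e \in F -> (e.1 == w) || (e.2 == w).
Proof.
move=> FD Fm; have neD a b : D a -> ~~ D b -> (a == b) = false.
  by move=> Da nDb; apply: contraNF nDb => /eqP<-.
have meet e f : e \in F -> f \in F -> (e.1 == f.1) || (e.2 == f.2).
  move=> eF fF; have [De nDe] := FD e eF; have [Df nDf] := FD f fF.
  have := Fm e f eF fF; rewrite /shares (neD _ _ De nDf) [e.2 == f.1]eq_sym.
  by rewrite (neD _ _ Df nDe).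
have [F0|[e eF]] := set_0Vmem F; first by exists w0 => e; rewrite F0 inE.
have [/forall_inP all1|] := boolP [forall f in F, f.1 == e.1].
  by exists e.1 => f fF; rewrite all1.
case/forall_inPn=> f fF ne1; have := meet _ _ fF eF; rewrite (negPf ne1) => /= /eqP e2.
exists e.2 => g gF; have := meet _ _ gF eF; case/orP=> [/eqP g1|->]; last by rewrite orbT.
by have := meet _ _ gF fF; rewrite g1 eq_sym (negPf ne1) e2 => /= ->; rewrite orbT.
Qed.

Section Cover.
Variables (h t : nat) (K T : sgraph) (phi : K -> T) (R : K -> K -> subgraph T).
Hypothesis treeT : is_tree T.
Hypothesis degT : max_degree_le T h.
Hypothesis h_ge3 : 3 <= h.
Hypothesis rep : tree_rep t phi R.
Variable D : pred K.

(* The edges whose trees run through a common path of the host tree are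
   classified by the next vertex of the path: after [t - 2] extensions of an
   edge all the edges in one class meet pairwise. *)
Lemma crossing_cover (k : nat) (x y : T) (p : seq T) (F : {set K * K}) :
  0 < #|K| -> path adj x (y :: p) -> uniq (x :: y :: p) ->
  t <= size (x :: y :: p) + k ->
  (forall e, e \in F -> [/\ adj e.1 e.2, D e.1, ~~ D e.2, sub_edge (R e.1 e.2) x y
     & {subset x :: y :: p <= sub_verts (R e.1 e.2)}]) ->
  exists2 X : {set K}, #|X| <= h.-1 ^ k &
    forall e, e \in F -> (e.1 \in X) || (e.2 \in X).
Proof.
case/card_gt0P=> w0 _.
have single k' (G : {set K * K}) :
    (forall e, e \in G -> [/\ adj e.1 e.2, D e.1 & ~~ D e.2]) ->
    (forall e f, e \in G -> f \in G ->
       t <= #|sub_verts (R e.1 e.2) :&: sub_verts (R f.1 f.2)| \/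
      (exists z, [/\ leaf z, z \in sub_verts (R e.1 e.2) & z \in sub_verts (R f.1 f.2)])) ->
    exists2 X : {set K}, #|X| <= h.-1 ^ k' &
      forall e, e \in G -> (e.1 \in X) || (e.2 \in X).
  move=> GD Gm; have [||w wP] := bipartite_star (D := D) (F := G) w0.
  - by move=> e /GD[].
  - move=> e f eG fG; apply: (rep_meet rep); last exact: Gm.
      by case: (GD e eG).
    by case: (GD f fG).
  - exists [set w]; first by rewrite cards1 expn_gt0; lia.
    by move=> e /wP; rewrite !inE.
elim: k x y p F => [|k IHk] x y p F pp up tle FP.
  apply: single => [e /FP[]//|e f eF fF]; left.
  rewrite addn0 in tle; apply: leq_trans tle _.
  rewrite -(card_uniqP up); apply: subset_leq_card; apply/subsetP => z zp.
  have [_ _ _ _ se] := FP e eF; have [_ _ _ _ sf] := FP f fF.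
  by rewrite inE se ?sf.
(* At a leaf of [T] the path stops growing, but all trees of [F] contain this leaf, so one class is
   left. *)
have [lx|nlx] := boolP (leaf x).
  apply: single => [e /FP[]//|e f eF fF]; right; exists x; split=> //.
    by case: (FP e eF) => _ _ _ _ -> //; rewrite mem_head.
  by case: (FP f fF) => _ _ _ _ -> //; rewrite mem_head.
pose Fz z := [set e in F | sub_edge (R e.1 e.2) x z].
have axy : adj x y by case/andP: pp.
have step z : z \in nbhd x :\ y -> exists2 X : {set K}, #|X| <= h.-1 ^ k &
    forall e, e \in Fz z -> (e.1 \in X) || (e.2 \in X).
  rewrite !inE => /andP[zy axz].
  apply: (IHk z x (y :: p)); first by rewrite /= adj_sym axz.
  - by rewrite cons_uniq up andbT (cycle_free_extension treeT).
  - by move: tle => /=; lia.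
  move=> e; rewrite inE => /andP[/FP[ae De nDe sxy sub] sxz].
  have szx : sub_edge (R e.1 e.2) z x by rewrite sub_edge_sym.
  split=> // c; rewrite inE => /orP[/eqP->|]; last exact: sub.
  by case/and3P: (sub_edgeP szx).
have [Xf XfP] : exists Xf : T -> {set K}, forall z, z \in nbhd x :\ y ->
    #|Xf z| <= h.-1 ^ k /\
    forall e, e \in Fz z -> (e.1 \in Xf z) || (e.2 \in Xf z).
  apply: (fin_all_exists (P := fun z (X : {set K}) => z \in nbhd x :\ y ->
     #|X| <= h.-1 ^ k /\ forall e, e \in Fz z -> (e.1 \in X) || (e.2 \in X))) => z.
  have [/step[X] ? ?|] := boolP (z \in nbhd x :\ y); first by exists X.
  by exists set0.
exists (\bigcup_(z in nbhd x :\ y) Xf z).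
  apply: (@leq_trans (\sum_(z in nbhd x :\ y) h.-1 ^ k)).
    elim/big_rec2: _ => [|z m E zn IH]; first by rewrite cards0.
    apply: leq_trans (leq_card_setU _ _) _; apply: leq_add => //.
    by case: (XfP z zn).
  rewrite sum_nat_const expnS leq_mul2r; apply/orP; right.
  have := degT x; rewrite /degree (cardsD1 y) inE axy /=; lia.
move=> e eF; have [ae De nDe sxy _] := FP e eF.
have [z zy sxz] := rep_through rep ae sxy nlx.
have zn : z \in nbhd x :\ y.
  by rewrite !inE zy; case/and3P: (sub_edgeP sxz).
have [_ /(_ e)] := XfP z zn; rewrite inE eF sxz => /(_ isT) /orP[eX|eX];
  apply/orP; [left|right]; by apply/bigcupP; exists z.
Qed.

End Cover.

Lemma rep_separation (h t : nat) (K T : sgraph) (phi : K -> T)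
    (R : K -> K -> subgraph T) :
  is_tree T -> max_degree_le T h -> 3 <= h -> tree_rep t phi R -> 3 <= #|K| ->
  exists X A B : {set K}, separation h (h.-1 ^ (t - 2)) X A B.
Proof.
move=> treeT degT h_ge3 rep K3.
have [x [y [axy wA wB]]] := balanced_edge treeT degT h_ge3 (rep_leaf rep) (rep_fibre rep) K3.
pose D := [pred u | phi u \in side x y].
pose F := [set e : K * K | [&& adj e.1 e.2, D e.1 & ~~ D e.2]].
have ayx : adj y x by rewrite adj_sym.
(* The common path starts with the two ends of the balanced edge, hence [t - 2] extensions. It is
   listed from its growing end, which is [y]. *)
have [|||||X Xle XP] := crossing_cover treeT degT h_ge3 rep (D := D) (k := t - 2)
   (x := y) (y := x) (p := [::]) (F := F).
- by apply: leq_trans K3.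
- by rewrite /= ayx.
- by rewrite /= inE andbT; apply: contraTneq axy => ->; rewrite adj_irr.
- by rewrite /=; lia.
- move=> e; rewrite !in_set => /and3P[ae De nDe].
  have [a [b [sab aS bS]]] := rep_cut rep (D := mem (side x y)) ae De nDe.
  have /and3P[av bv aab] := sub_edgeP sab.
  have aba : adj b a by rewrite adj_sym.
  have [eb ea] := side_crossing axy aba bS aS; subst.
  by split=> // c; rewrite !inE => /orP[] /eqP->.
exists X, [set u | D u], [set u | ~~ D u]; split=> //.
- by apply/setP => u; rewrite !in_set /= orbN.
- by apply/setP => u; rewrite !in_set /= andbN.
move=> u v; rewrite !in_setD !in_set => /andP[uX Du] /andP[vX nDv] auv.
have := XP (u, v); rewrite in_set /= auv (negPf uX) (negPf vX).
by move: Du nDv => /= -> -> /(_ isT).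
Qed.

(** * Edge labellings with meeting labels *)

Lemma eq_set2 (T : finType) (A : {set T}) (x y : T) :
  #|A| <= 2 -> x \in A -> y \in A -> x != y -> A = [set x; y].
Proof.
move=> A2 xA yA ne; apply/esym/eqP; rewrite eqEcard cards2 ne A2 andbT.
by apply/subsetP => z; rewrite !inE => /orP[] /eqP->.
Qed.

Lemma shares_sym (V : eqType) (u v u' v' : V) :
  shares u v u' v' = shares u' v' u v.
Proof.
rewrite /shares (eq_sym u) (eq_sym u v') (eq_sym v u') (eq_sym v v').
by do 4!case: eqP => _ //=.
Qed.

Lemma sharesE (V : finType) (u v u' v' : V) :
  shares u v u' v' = ([set u; v] :&: [set u'; v'] != set0).
Proof.
apply/idP/set0Pn => [|[x]].
  by case/or4P=> /eqP E; [exists u|exists u|exists v|exists v]; rewrite !inE E eqxx ?orbT.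
rewrite !inE /shares => /andP[/orP[]/eqP-> /orP[]/eqP->]; by rewrite eqxx ?orbT.
Qed.

Lemma shares_refl (V : eqType) (u v : V) : shares u v u v.
Proof. by rewrite /shares eqxx. Qed.

Section EdgeLabelling.
Variables (H : sgraph) (T : finType) (L : H -> H -> {set T}).
Hypothesis connH : forall u v : H, connect adj u v.
Hypothesis edges4 : 3 < #|edges H|.
Hypothesis L_sym : forall u v, L u v = L v u.
Hypothesis L_neq0 : forall u v, adj u v -> L u v != set0.
Hypothesis L_le2 : forall u v, adj u v -> #|L u v| <= 2.
Hypothesis L_meet : forall u v u' v', adj u v -> adj u' v' ->
  (L u v :&: L u' v' != set0) = shares u v u' v'.
Hypothesis L_inj : forall u v u' v', adj u v -> adj u' v' ->
  L u v = L u' v' -> [set u; v] = [set u'; v'].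

(** [g u v] is the edge whose label set is used for [uv]: it is [uv] itself unless two opposite
    edges are exchanged. *)
Definition relabelling (phi : H -> T) (g : H -> H -> H * H) : Prop :=
  [/\ forall x, #|[set u | phi u == x]| <= 2,
      forall u v, adj u v ->
        [/\ adj (g u v).1 (g u v).2, phi u \in L (g u v).1 (g u v).2
          & phi v \in L (g u v).1 (g u v).2]
    & forall u v u' v', adj u v -> adj u' v' ->
        shares (g u v).1 (g u v).2 (g u' v').1 (g u' v').2 -> shares u v u' v'].

Lemma adj_neq (u v : H) : adj u v -> u != v.
Proof. by apply: contraTneq => ->; rewrite adj_irr. Qed.

Lemma L_common u v u' v' x : adj u v -> adj u' v' ->
  x \in L u v -> x \in L u' v' -> shares u v u' v'.
Proof.
move=> a a' xL xL'; rewrite -L_meet //; apply/set0Pn; exists x.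
by rewrite inE xL xL'.
Qed.

Lemma L_sharedP u v u' v' : adj u v -> adj u' v' -> shares u v u' v' ->
  exists2 x, x \in L u v & x \in L u' v'.
Proof.
by move=> a a'; rewrite -L_meet // => /set0Pn[x]; rewrite inE => /andP[]; exists x.
Qed.

Lemma L_inj_at v a b : adj v a -> adj v b -> L v a = L v b -> a = b.
Proof.
move=> va vb /(L_inj va vb)/eqP; rewrite set2_eq eqxx /=.
by case/orP=> [/eqP//|/andP[/eqP<- /eqP]].
Qed.

(** Refutes the small graphs in which the case analyses end: the single vertex, the single edge, the
    triangle and the claw. Shorter edge lists are padded with [set0]. *)
Lemma edges_subset3 (e1 e2 e3 : {set H}) :
  ~ (forall u v, adj u v -> [|| [set u; v] == e1, [set u; v] == e2 | [set u; v] == e3]).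
Proof.
move=> all3; suff: #|edges H| <= 3 by rewrite leqNgt edges4.
apply: (@leq_trans #|[set e1; e2; e3]|).
  apply: subset_leq_card; apply/subsetP => e.
  rewrite !inE => /existsP[u /existsP[v /andP[auv /eqP->]]].
  by rewrite -orbA; apply: all3.
rewrite !cardsU !cards1; lia.
Qed.

Lemma closed_full (P : pred H) u0 :
  P u0 -> (forall u v, P u -> adj u v -> P v) -> forall u, P u.
Proof.
move=> Pu0 cl u; apply/negbNE/negP => nP.
by have [x [y [axy Px]]] := connect_cut (connH u0 u) Pu0 nP; rewrite (cl x y).
Qed.

(** * The exceptional graphs of order four *)

Section Exceptional.
Variables (v a b c : H) (p q r : T).
Hypotheses (va : adj v a) (vb : adj v b) (vc : adj v c) (ab : adj a b).
Hypotheses (ac_neq : a != c) (bc_neq : b != c).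
Hypotheses (Lva : L v a = [set p; q]) (Lvb : L v b = [set q; r])
  (Lvc : L v c = [set p; r]).
Hypotheses (pq : p != q) (qr : q != r) (pr : p != r).
Hypothesis all4 : forall u, [|| u == v, u == a, u == b | u == c].

(** The second label of [ab]. If [q] is the only one, the default gives [c] the same label as [v],
    which the bound on the fibres permits. *)
Let s := odflt q [pick y in L a b | y != q].

Let neqs := (negPf (adj_neq va), negPf (adj_neq vb), negPf (adj_neq vc),
  negPf (adj_neq ab), negPf ac_neq, negPf bc_neq,
  (eq_sym a v, eq_sym b v, eq_sym c v, eq_sym b a, eq_sym c a, eq_sym c b)).

Let notin_ab x : x \in L v c -> x \notin L a b.
Proof.
move=> xc; apply/negP => xab; have := L_common vc ab xc xab.
by rewrite /shares !neqs.
Qed.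

Let p_ab : p \notin L a b. Proof. by apply: notin_ab; rewrite Lvc !inE eqxx. Qed.
Let r_ab : r \notin L a b. Proof. by apply: notin_ab; rewrite Lvc !inE eqxx orbT. Qed.

Let q_ab : q \in L a b.
Proof.
have sh : shares v a a b by rewrite /shares eqxx !orbT.
have [x] := L_sharedP va ab sh; rewrite Lva !inE => /orP[]/eqP-> //.
by rewrite (negPf p_ab).
Qed.

Let s_ab : s \in L a b.
Proof. by rewrite /s; case: pickP => [y /andP[]|] //=; rewrite q_ab. Qed.

Let s_uniq y : y \in L a b -> y != q -> y = s.
Proof.
move=> yab yq; rewrite /s; case: pickP => [z /andP[zab zq] /=|/(_ y)]; last first.
  by rewrite /= yab yq.
have := yab; rewrite (eq_set2 (L_le2 ab) zab q_ab zq) !inE (negPf yq) orbF.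
by move/eqP.
Qed.

(** The edge [ac] is disjoint from [vb] and so avoids [q] and [r]. Meeting [va] then forces [p], and
    meeting [ab] forces [s]. *)
Let ac_ps : adj a c -> p \in L a c /\ s \in L a c.
Proof.
move=> ac.
have nqr x : x \in L v b -> x \notin L a c.
  move=> xc; apply/negP => xac; have := L_common vb ac xc xac.
  by rewrite /shares !neqs.
split.
  have sh : shares v a a c by rewrite /shares eqxx !orbT.
  have [x] := L_sharedP va ac sh; rewrite Lva !inE => /orP[]/eqP-> // qac.
  by move: (nqr q); rewrite Lvb !inE eqxx qac => /(_ isT).
have sh : shares a b a c by rewrite /shares eqxx.
have [x xab xac] := L_sharedP ab ac sh; rewrite -(s_uniq xab) //.
by apply: contraTneq xac => ->; apply: nqr; rewrite Lvb !inE eqxx.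
Qed.

Let bc_rs : adj b c -> r \in L b c /\ s \in L b c.
Proof.
move=> bc.
have npq x : x \in L v a -> x \notin L b c.
  move=> xc; apply/negP => xbc; have := L_common va bc xc xbc.
  by rewrite /shares !neqs.
split.
  have sh : shares v b b c by rewrite /shares eqxx !orbT.
  have [x] := L_sharedP vb bc sh; rewrite Lvb !inE => /orP[]/eqP-> // qbc.
  by move: (npq q); rewrite Lva !inE eqxx orbT qbc => /(_ isT).
have sh : shares a b b c by rewrite /shares eqxx !orbT.
have [x xab xbc] := L_sharedP ab bc sh; rewrite -(s_uniq xab) //.
by apply: contraTneq xbc => ->; apply: npq; rewrite Lva !inE eqxx orbT.
Qed.

(* The labels of the star at [v] form a triangle, so the labelling is induced
   by no vertex map; exchanging the two opposite edges [vc] and [ab] repairs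
   this. *)
Lemma exceptional_relabelling : exists phi g, relabelling phi g.
Proof.
(* After the exchange, [va], [vb], [vc] and [ab] carry [pq], [qr], [qs] and [pr], which are the
   values of [phi] at their ends. *)
pose phi u := if u == v then q else if u == a then p else if u == b then r else s.
pose g u w := if [set u; w] == [set v; c] then (a, b) else
  if [set u; w] == [set a; b] then (v, c) else (u, w).
have neq_ps : p == s = false by apply: contraNF p_ab => /eqP->.
have neq_rs : r == s = false by apply: contraNF r_ab => /eqP->.
have nvcab : shares v c a b = false by rewrite /shares !neqs.
(* On four vertices every other edge meets both [vc] and [ab], so the exchange preserves
   incidence. *)
have cross u w : adj u w -> [set u; w] != [set v; c] -> [set u; w] != [set a; b] ->
    shares u w v c /\ shares u w a b.
  move=> auw; rewrite !set2_eq /shares.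
  case/or4P: (all4 u) => /eqP eu; case/or4P: (all4 w) => /eqP ew;
    move: auw; rewrite eu ew ?adj_irr ?eqxx ?orbT ?andbT //=.
have phv : phi v = q by rewrite /phi eqxx.
have pha : phi a = p by rewrite /phi [a == v]eq_sym !neqs eqxx.
have phb : phi b = r by rewrite /phi ![b == _]eq_sym !neqs eqxx.
have phc : phi c = s by rewrite /phi ![c == _]eq_sym !neqs.
pose PP u w := adj u w -> [/\ adj (g u w).1 (g u w).2,
    phi u \in L (g u w).1 (g u w).2 & phi w \in L (g u w).1 (g u w).2].
have gP u w : PP u w.
  have gsym x y : PP x y -> PP y x.
    rewrite /PP /g (setUC [set y]) adj_sym => PPxy /PPxy {PPxy}.
    case: ifP => _; first by case.
    case: ifP => _; first by case.
    by case=> axy ? ?; rewrite /= L_sym adj_sym.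
  have Pva : PP v a.
    by rewrite /PP /g !set2_eq ?eqxx ![a == _]eq_sym !neqs phv pha /= Lva !inE !eqxx orbT.
  have Pvb : PP v b.
    by rewrite /PP /g !set2_eq ?eqxx ![b == _]eq_sym !neqs phv phb /= Lvb !inE !eqxx orbT.
  have Pvc : PP v c by rewrite /PP /g eqxx phv phc.
  have Pab : PP a b.
    by rewrite /PP /g eqxx set2_eq ![a == _]eq_sym !neqs pha phb /= Lvc !inE !eqxx orbT.
  have Pac : PP a c.
    rewrite /PP /g !set2_eq ?eqxx ![a == _]eq_sym ![c == _]eq_sym !neqs pha phc /=.
    by move=> ac; have [] := ac_ps ac.
  have Pbc : PP b c.
    rewrite /PP /g !set2_eq ?eqxx ![b == _]eq_sym ![c == _]eq_sym !neqs phb phc /=.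
    by move=> bc; have [] := bc_rs bc.
  have Pirr x : PP x x by rewrite /PP adj_irr.
  case/or4P: (all4 u) => /eqP->; case/or4P: (all4 w) => /eqP->;
    [exact: Pirr | exact: Pva | exact: Pvb | exact: Pvc
    |exact: (gsym _ _ Pva) | exact: Pirr | exact: Pab | exact: Pac
    |exact: (gsym _ _ Pvb) | exact: (gsym _ _ Pab) | exact: Pirr | exact: Pbc
    |exact: (gsym _ _ Pvc) | exact: (gsym _ _ Pac) | exact: (gsym _ _ Pbc) | exact: Pirr].
exists phi, g; split => //.
(* The labels [p], [q], [r] are distinct, so only [c] can double another vertex. *)
- move=> x; have: #|[set u | phi u == x] :\ c| <= 1.
    apply/card_le1_eqP => u w; rewrite !inE => /andP[uc /eqP <-] /andP[wc /eqP].
    move: uc wc; case/or4P: (all4 u) => /eqP->; case/or4P: (all4 w) => /eqP->;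
      rewrite ?eqxx // ?phv ?pha ?phb => _ _ E;
      by move: pq qr pr; rewrite E ?eqxx.
  by move=> le1; rewrite (cardsD1 c); apply: leq_add (leq_b1 _) le1.
- move=> u w u' w' auw auw'; rewrite /g.
  have sub x y x' y' z t z' t' : [set x; y] = [set z; t :> H] ->
      [set x'; y'] = [set z'; t'] -> shares z t z' t' -> shares x y x' y'.
    by rewrite !sharesE => -> ->.
  have ncross := cross u w auw; have ncross' := cross u' w' auw'.
  case: ifPn => [/eqP e1|n1]; [|case: ifPn => [/eqP e2|n2]];
  (case: ifPn => [/eqP e1'|n1']; [|case: ifPn => [/eqP e2'|n2']]) => //= sh.
  + by apply: sub e1 e1' (shares_refl _ _).
  + by rewrite shares_sym nvcab in sh.
  + by apply: sub e1 (erefl _) _; rewrite shares_sym; case: ncross'.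
  + by rewrite nvcab in sh.
  + by apply: sub e2 e2' (shares_refl _ _).
  + by apply: sub e2 (erefl _) _; rewrite shares_sym; case: ncross'.
  + by apply: sub (erefl _) e1' _; case: ncross.
  + by apply: sub (erefl _) e2' _; case: ncross.
Qed.
End Exceptional.

(** An edge [au] with [u != v] shares [p] or [q] with [va]. These labels also occur on [vc] and [vb]
    respectively, so [au] meets that edge too, at [c] or at [b]. *)
Lemma star_triangle v a b c p q r :
  adj v a -> adj v b -> adj v c ->
  L v a = [set p; q] -> L v b = [set q; r] -> L v c = [set p; r] ->
  p != q -> q != r -> p != r ->
  forall u, adj a u -> [|| u == v, u == b | u == c].
Proof.
move=> va vb vc Lva Lvb Lvc pq qr pr u au.
have av : a != v by rewrite eq_sym adj_neq.
have ab : a != b by apply: contraTneq pr => E; have /setP/(_ p) := Lva;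
  rewrite E Lvb !inE eqxx (negPf pq) /= => ->.
have ac : a != c by apply: contraTneq qr => E; have /setP/(_ q) := Lva;
  rewrite E Lvc !inE eqxx orbT eq_sym (negPf pq) => /= ->.
have [//|uv /=] := eqVneq u v.
have sh : shares v a a u by rewrite /shares eqxx !orbT.
have [x xva xau] := L_sharedP va au sh.
move: xva; rewrite Lva !inE => /orP[]/eqP E; subst x.
  have pvc : p \in L v c by rewrite Lvc !inE eqxx.
  have := L_common vc au pvc xau.
  by rewrite /shares ![v == _]eq_sym (negPf av) (negPf uv) ![c == _]eq_sym (negPf ac) => /= ->; rewrite orbT.
have qvb : q \in L v b by rewrite Lvb !inE eqxx.
have := L_common vb au qvb xau.
by rewrite /shares ![v == _]eq_sym (negPf av) (negPf uv) ![b == _]eq_sym (negPf ab) => /= ->.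
Qed.

(* A family of at least three distinct, pairwise meeting sets of size at most
   two without a common element is a triangle. *)
Lemma no_common_label v :
  (exists w, adj v w) -> ~ (exists x, forall w, adj v w -> x \in L v w) ->
  exists phi g, relabelling phi g.
Proof.
move=> [a va] nocommon.
have [x0 x0a] : exists x, x \in L v a by apply/set0Pn; apply: L_neq0.
have nc x : exists2 w, adj v w & x \notin L v w.
  apply/exists_inP; apply/negbNE/negP => /exists_inPn none.
  by apply: nocommon; exists x => w vw; apply/negbNE/none.
have [b vb x0b] := nc x0.
have meet w w' : adj v w -> adj v w' -> exists2 x, x \in L v w & x \in L v w'.
  by move=> vw vw'; apply: L_sharedP => //; rewrite /shares eqxx.
have [q qa qb] := meet _ _ va vb.
have [c vc qc] := nc q.
have [p pa pc] := meet _ _ va vc.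
have [r rb rc] := meet _ _ vb vc.
have pq : p != q by apply: contraNneq qc => <-.
have qr : q != r by apply: contraNneq qc => ->.
have Lva := eq_set2 (L_le2 va) pa qa pq.
have Lvb := eq_set2 (L_le2 vb) qb rb qr.
have neq_ab : a != b by apply: contraNneq x0b => <-.
have pr : p != r.
  apply: contra_neq neq_ab => E; apply: (L_inj_at va vb).
  by rewrite Lva Lvb E setUC.
have Lvc := eq_set2 (L_le2 vc) pc rc pr.
have neq_ac : a != c by apply: contraNneq qc => <-.
have neq_bc : b != c by apply: contraNneq qc => <-.
(* A set of at most two labels that meets all three sides of the triangle contains two corners,
   hence equals a side, and [L_inj_at] applies. *)
have Nv w : adj v w -> [|| w == a, w == b | w == c].
  move=> vw; apply/negbNE/negP; rewrite !negb_or => /and3P[wa wb wc].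
  have two x y z : adj v z -> L v z = [set x; y] -> x != y -> w != z ->
      x \in L v w -> y \in L v w -> False.
    move=> vz Lz xy wz xw yw; case/eqP: wz; apply: (L_inj_at vw vz).
    by rewrite Lz; apply: eq_set2 => //; apply: L_le2.
  have [x] := meet _ _ vw va; rewrite Lva !inE => xw /orP[]/eqP E; subst x.
    have [y] := meet _ _ vw vb; rewrite Lvb !inE => yw /orP[]/eqP E; subst y.
      exact: (two p q a).
    exact: (two p r c).
  have [y] := meet _ _ vw vc; rewrite Lvc !inE => yw /orP[]/eqP E; subst y.
    exact: (two p q a).
  exact: (two q r b).
have Na := star_triangle va vb vc Lva Lvb Lvc pq qr pr.
have qp : q != p by rewrite eq_sym.
have rq : r != q by rewrite eq_sym.
have rp : r != p by rewrite eq_sym.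
have Lva' : L v a = [set q; p] by rewrite setUC.
have Lvb' : L v b = [set r; q] by rewrite setUC.
have Lvc' : L v c = [set r; p] by rewrite setUC.
have Nb := star_triangle vb va vc Lvb' Lva' Lvc' rq qp rp.
have Nc := star_triangle vc vb va Lvc Lvb' Lva pr rq pq.
have all4 u : [|| u == v, u == a, u == b | u == c].
  apply: (@closed_full [pred u | [|| u == v, u == a, u == b | u == c]] v) => /=.
    by rewrite eqxx.
  move=> {}u w /or4P[]/eqP-> aw.
  - by case/or3P: (Nv w aw) => ->; rewrite ?orbT.
  - by case/or3P: (Na w aw) => ->; rewrite ?orbT.
  - by case/or3P: (Nb w aw) => ->; rewrite ?orbT.
  - by case/or3P: (Nc w aw) => ->; rewrite ?orbT.
have cb : c != b by rewrite eq_sym.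
have ca : c != a by rewrite eq_sym.
have ba : b != a by rewrite eq_sym.
(* Any edge among [a], [b], [c] can play the part of [ab] after renaming; without one the graph is a
   claw. *)
have [ab|nab] := boolP (adj a b).
  exact: (@exceptional_relabelling v a b c p q r).
have [ac|nac] := boolP (adj a c).
  apply: (@exceptional_relabelling v a c b q p r) => // u.
  by case/or4P: (all4 u) => ->; rewrite ?orbT.
have [bc|nbc] := boolP (adj b c).
  apply: (@exceptional_relabelling v b c a q r p) => // u.
  by case/or4P: (all4 u) => ->; rewrite ?orbT.
case: (@edges_subset3 [set v; a] [set v; b] [set v; c]) => u w.
have nba : ~~ adj b a by rewrite adj_sym.
have nca : ~~ adj c a by rewrite adj_sym.
have ncb : ~~ adj c b by rewrite adj_sym.
case/or4P: (all4 u) => /eqP->; case/or4P: (all4 w) => /eqP->;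
  by rewrite ?adj_irr ?(negPf nab, negPf nac, negPf nbc, negPf nba, negPf nca, negPf ncb)
    ?(setUC [set _] [set v]) ?eqxx ?orbT.
Qed.

Lemma has_neighbour (v : H) : exists w, adj v w.
Proof.
apply/existsP; apply/negbNE/negP => /existsPn none.
have full : forall u, u == v.
  apply: (@closed_full (pred1 v) v) => /= [|u w /eqP-> avw]; first exact: eqxx.
  by have := none w; rewrite avw.
case: (@edges_subset3 set0 set0 set0) => u w.
by rewrite (eqP (full u)) (eqP (full w)) adj_irr.
Qed.

(** * Labels common to all edges at a vertex *)

Section CommonLabels.
Variable psi : H -> T.
Hypothesis psiP : forall v w, adj v w -> psi v \in L v w.

Let psiP' v w : adj v w -> psi w \in L v w.
Proof. by rewrite adj_sym L_sym => /psiP. Qed.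

Let pendant (u : H) := #|nbhd u| == 1.

Let second (u : H) : ~~ pendant u -> forall w, exists2 w', adj u w' & w' != w.
Proof.
move=> np w; have [w0 uw0] := has_neighbour u.
have [E|ne] := eqVneq w0 w; last by exists w0.
subst w0; have: 0 < #|nbhd u :\ w|.
  move: np; rewrite /pendant (cardsD1 w) inE uw0 /= add1n eqSS -lt0n //.
by case/card_gt0P=> w'; rewrite !inE => /andP[? ?]; exists w'.
Qed.

Let pendant_nbhd u w w' : pendant u -> adj u w -> adj u w' -> w' = w.
Proof.
move=> /eqP/eq_leq/card_le1_eqP pu uw uw'; apply: pu; by rewrite inE.
Qed.

(** Equal labels make every edge at [u] meet every edge at [v], so [u] and [v] lie in a triangle
    [uva] and have no further neighbours. If [a] has another neighbour [b], then [ab] is disjoint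
    from [uv], so [psi a] differs from the common label and [au], [av] get the same label set;
    otherwise the graph is a triangle. *)
Lemma psi_inj u v : ~~ pendant u -> ~~ pendant v -> psi u = psi v -> u = v.
Proof.
move=> pu pv E; apply/eqP/negbNE/negP => uv.
have touch a b : adj u a -> adj v b -> shares u a v b.
  by move=> ua vb; apply: (L_common ua vb (psiP ua)); rewrite E; apply: psiP.
have [a ua av] := second pu v.
have Nv b : adj v b -> (b == u) || (b == a).
  move=> vb; have := touch a b ua vb; rewrite /shares (negPf uv) (negPf av) /=.
  by rewrite (eq_sym u) (eq_sym a).
have va : adj v a.
  have [b vb bu] := second pv u.
  by have := Nv b vb; rewrite (negPf bu) => /= /eqP <-.
have vu : adj v u.
  have [b vb ba] := second pv a.
  by have := Nv b vb; rewrite (negPf ba) orbF => /eqP <-.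
have Nu b : adj u b -> (b == v) || (b == a).
  move=> ub; have := touch b a ub va; rewrite /shares (negPf uv).
  by rewrite (negPf (adj_neq ua)).
have uv' : adj u v by rewrite adj_sym.
have au : adj a u by rewrite adj_sym.
have av' : adj a v by rewrite adj_sym.
have [/existsP[b /and3P[ab bu bv]]|/existsPn tri] :=
    boolP [exists b, [&& adj a b, b != u & b != v]].
  have [Ea|Ea] := eqVneq (psi a) (psi u).
    have := L_common ab uv' (psiP ab); rewrite Ea => /(_ (psiP uv')).
    by rewrite /shares (negPf (adj_neq au)) (negPf (adj_neq av')) (negPf bu) (negPf bv).
  case/eqP: uv; apply: (L_inj_at au av').
  rewrite (eq_set2 (L_le2 au) (psiP au) (psiP' au) Ea).
  by rewrite (eq_set2 (L_le2 av') (psiP av') (psiP' av')) -?E.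
have all3 w : [|| w == u, w == v | w == a].
  apply: (@closed_full [pred w | [|| w == u, w == v | w == a]] u) => /=.
    by rewrite eqxx.
  move=> {}w z /or3P[]/eqP-> az.
  - by rewrite (Nu z az) orbT.
  - by case/orP: (Nv z az) => ->; rewrite ?orbT.
  - by have := tri z; rewrite az /= -negb_or negbK => /orP[]->; rewrite ?orbT.
case: (@edges_subset3 [set u; v] [set u; a] [set v; a]) => w z.
case/or3P: (all3 w) => /eqP->; case/or3P: (all3 z) => /eqP->;
  by rewrite ?adj_irr ?(setUC [set v] [set u]) ?(setUC [set a]) ?eqxx ?orbT.
Qed.

Let nb (u : H) : H := odflt u [pick w | adj u w].

Let nbP u : adj u (nb u).
Proof.
rewrite /nb; case: pickP => //= none; have [w uw] := has_neighbour u.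
by rewrite none in uw.
Qed.

Let phi u := if pendant u then
  odflt (psi (nb u)) [pick y in L u (nb u) | y != psi (nb u)] else psi u.

Let phiP u w : adj u w -> phi u \in L u w.
Proof.
move=> uw; rewrite /phi; case: ifPn => [pu|_]; last exact: psiP.
rewrite -(pendant_nbhd pu uw (nbP u)); case: pickP => [y /andP[]//|_] /=.
exact: psiP' (nbP u).
Qed.

Let pendant_nb u : pendant u -> ~~ pendant (nb u).
Proof.
move=> pu; apply/negP => pw; have nu : adj (nb u) u by rewrite adj_sym nbP.
have all2 w : (w == u) || (w == nb u).
  apply: (@closed_full [pred w | (w == u) || (w == nb u)] u) => /=.
    by rewrite eqxx.
  move=> {}w z /orP[]/eqP-> az; first by rewrite (pendant_nbhd pu (nbP u) az) eqxx orbT.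
  by rewrite (pendant_nbhd pw nu az) eqxx.
case: (@edges_subset3 [set u; nb u] set0 set0) => w z.
case/orP: (all2 w) => /eqP->; case/orP: (all2 z) => /eqP->;
  by rewrite ?adj_irr ?(setUC [set nb u]) ?eqxx.
Qed.

(* The label of a pendant vertex is the label of its edge not used by the
   other end, if there is one. *)
Let pendant_label u y : pendant u -> phi u = psi (nb u) -> y \in L u (nb u) ->
  y = psi (nb u).
Proof.
move=> pu; rewrite /phi pu; case: pickP => [z /andP[_ ne] /= E|none _ yL].
  by rewrite E eqxx in ne.
by have := none y; rewrite yL => /negbFE/eqP.
Qed.

(** The two pendant edges meet, necessarily in a common neighbour. Their label sets then agree: both
    consist of [phi u] and the label of the neighbour, which may coincide. *)
Let pendant_phi_inj u v : pendant u -> pendant v -> phi u = phi v -> u = v.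
Proof.
move=> pu pv E; apply/eqP/negbNE/negP => uv.
have nvu : nb v != u by apply: contraTneq pu => <-; apply: pendant_nb.
have nuv : nb u != v by apply: contraTneq pv => <-; apply: pendant_nb.
have vP : phi u \in L v (nb v) by rewrite E; apply: phiP; apply: nbP.
have := L_common (nbP u) (nbP v) (phiP (nbP u)) vP.
rewrite /shares (negPf uv) (eq_sym u) (negPf nvu) (negPf nuv) /= => /eqP nn.
case/eqP: uv.
have nu : adj (nb u) u by rewrite adj_sym nbP.
have nv : adj (nb u) v by rewrite nn adj_sym nbP.
apply: (L_inj_at nu nv); rewrite L_sym (L_sym (nb u) v).
have uv : adj u (nb u) := nbP u.
have vv : adj v (nb u) by rewrite adj_sym.
have [Eu|ne] := eqVneq (phi u) (psi (nb u)); last first.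
  rewrite (eq_set2 (L_le2 uv) (phiP uv) (psiP' uv) ne).
  by rewrite (eq_set2 (L_le2 vv) (phiP vv) (psiP' vv)) -?E.
have one w : adj w (nb u) -> (forall y, y \in L w (nb u) -> y = psi (nb u)) ->
    L w (nb u) = [set psi (nb u)].
  move=> wn all1; apply/setP => y; rewrite inE; apply/idP/eqP => [/all1//|->].
  exact: psiP'.
have -> : L u (nb u) = [set psi (nb u)].
  by apply: one uv _ => y yL; apply: pendant_label pu Eu yL.
have -> // : L v (nb u) = [set psi (nb u)].
apply: one vv _ => y; rewrite {1}nn => yL.
by rewrite nn; apply: pendant_label pv _ yL; rewrite -E Eu nn.
Qed.

(** The bound two on the fibres comes from the pendant and the other vertices, each labelled
    injectively. *)
Lemma common_relabelling : exists f g, relabelling f g.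
Proof.
exists phi, (fun u v => (u, v)); split=> /= [x|u v uv|//]; last first.
  by split=> //; [exact: phiP | rewrite L_sym; apply: phiP; rewrite adj_sym].
rewrite -(cardsID [set u | pendant u]) (leq_add (n1 := 1) (n2 := 1)) //.
  apply/card_le1_eqP => u v; rewrite !inE => /andP[/eqP<- pu] /andP[/eqP E pv].
  exact: pendant_phi_inj.
apply/card_le1_eqP => u v; rewrite !inE => /andP[pu /eqP<-] /andP[pv].
by rewrite /phi (negPf pu) (negPf pv) => /eqP E; apply: psi_inj.
Qed.

End CommonLabels.

Lemma relabelling_exists : exists f g, relabelling f g.
Proof.
have [all_common|] := boolP [forall v, exists x, [forall (w | adj v w), x \in L v w]].
  have [psi psiP] : exists psi : H -> T, forall v w, adj v w -> psi v \in L v w.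
    apply: (fin_all_exists (P := fun v x => forall w, adj v w -> x \in L v w)) => v.
    have /existsP[x /forall_inP xP] := forallP all_common v.
    by exists x.
  exact: common_relabelling psiP.
case/forallPn=> v /existsPn none; apply: (no_common_label (has_neighbour v)).
by case=> x xP; case/forall_inP: (none x).
Qed.

End EdgeLabelling.

(** * Orthodox representations of line graphs *)

Section PathEnds.
Variable G : sgraph.
Hypothesis connG : forall u v : G, connect adj u v.
Hypothesis deg2 : max_degree_le G 2.

Let degree1 (z w w' : G) : degree z <= 1 -> adj z w -> adj z w' -> w = w'.
Proof. by move/card_le1_eqP=> z1 zw zw'; apply: z1; rewrite inE. Qed.

Let degree2 (z w w1 w2 : G) :
  adj z w1 -> adj z w2 -> w1 != w2 -> adj z w -> (w == w1) || (w == w2).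
Proof.
move=> z1 z2 ne zw; have E : nbhd z = [set w1; w2].
  by apply: eq_set2 => //; [exact: deg2 | rewrite inE | rewrite inE].
have wz : w \in nbhd z by rewrite inE.
by move: wz; rewrite E !inE.
Qed.

Let path_interior (y x : G) p : path adj y (x :: p) -> uniq (y :: x :: p) ->
  degree (last x p) <= 1 -> forall z, z \in x :: p ->
  (forall w, adj z w -> w \in y :: x :: p) /\ (degree z <= 1 -> z = last x p).
Proof.
elim: p y x => [|x' p IHp] y x.
  rewrite /= andbT => yx _ d1 z; rewrite inE => /eqP->; split=> // w xw.
  by rewrite (degree1 d1 xw (w' := y)) ?mem_head // adj_sym.
move=> /andP[yx pp] /andP[yn up] d1 z.
have xy : adj x y by rewrite adj_sym.
have xx' : adj x x' by case/andP: pp.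
have ne : y != x' by apply: contraNneq yn => ->; rewrite !inE eqxx orbT.
rewrite inE => /orP[/eqP->|zp].
  split=> [w xw|z1]; last by case/eqP: ne; apply: degree1 z1 xy xx'.
  by case/orP: (degree2 xy xx' ne xw) => /eqP->; rewrite !inE eqxx ?orbT.
have [closed ends] := IHp x x' pp up d1 z zp.
by split=> // w /closed wp; rewrite inE wp orbT.
Qed.

(** A path joining two vertices of degree at most one cannot be left, as its inner vertices have
    both neighbours on it. It therefore contains every vertex, and a third end would be an inner
    vertex of degree two. *)
Lemma path_ends : #|[set u : G | degree u <= 1]| <= 2.
Proof.
rewrite leqNgt; apply/negP => /card_gt2P[a [b [c [[aD bD cD] [ab bc ca]]]]].
move: aD bD cD; rewrite !inE => da db dc.
have /connectP[p0] := connG a b; case/shortenP=> [[|x p] pp up _ lb].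
  by rewrite /= in lb; rewrite lb eqxx in ab.
have dl : degree (last x p) <= 1 by rewrite /= in lb; rewrite -lb.
have inner := path_interior pp up dl.
have: c \in a :: x :: p.
  apply/negbNE/negP => nc.
  have [z [w [zw zp]]] := connect_cut (D := mem (a :: x :: p)) (connG a c) (mem_head _ _) nc.
  case/negP; move: zp; rewrite /= inE => /orP[/eqP E|zp]; last first.
    by case: (inner z zp) => cl _; apply: cl.
  have az : adj a x by case/andP: pp.
  by rewrite E in zw; rewrite (degree1 da zw az) !inE eqxx orbT.
rewrite inE (negPf ca) => /= cp.
by have [_ /(_ dc) E] := inner c cp; rewrite /= in lb; rewrite lb -E eqxx in bc.
Qed.

End PathEnds.

Lemma orth_tree_rep (h t : nat) (G H : sgraph) :
  connected G -> twin_free G -> 4 <= #|G| -> connected H ->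
  iso (line_graph H) G -> ORTH h 2 t G ->
  exists (T : sgraph) (phi : H -> T) (R : H -> H -> subgraph T),
    [/\ is_tree T, max_degree_le T h & tree_rep t phi R].
Proof.
move=> [_ connG] twinG G4 [_ connH] [f [bijf fadj]] [T [S [[treeT degT] treeS leafS orth]]].
have injf := bij_inj bijf.
have cardG : #|edges H| = #|G|.
  by rewrite -(bij_eq_card bijf) /= card_sig.
have /card_gt0P[e0 _] : 0 < #|{: line_vertex H}|.
  by rewrite card_sig cardG; apply: ltn_trans G4.
pose le (u v : H) : line_vertex H := insubd e0 [set u; v].
have leE u v : adj u v -> val (le u v) = [set u; v].
  move=> uv; rewrite insubdK // inE; apply/existsP; exists u; apply/existsP.
  by exists v; rewrite uv eqxx.
pose Lam (x : G) := [set y : T | leaf y & y \in sub_verts (S x)].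
have orth_adj x y : x != y -> adj x y = (Lam x :&: Lam y != set0).
  (* Positions 0, 1 and 2 in the list [tf] are adjacency, [t] common vertices and a common leaf. *)
  move=> xy; have tf := orth x y (elimN eqP xy); apply/idP/set0Pn.
    by move/(tf 0 2) => -[z [lz zx zy]]; exists z; rewrite !inE lz zx zy.
  case=> z; rewrite !inE => /andP[/andP[lz zx] /andP[_ zy]].
  by apply/(tf 0 2); exists z.
have Lam_neq0 x : Lam x != set0.
  have: 0 < #|[set~ x]| by rewrite cardsC1; lia.
  case/card_gt0P=> y; rewrite !inE => yx.
  have [|a [b [ab /eqP ax _]]] := connect_cut (D := pred1 x) (connG x y) (eqxx x); first exact: yx.
  subst a; have ne : x != b by apply: contraTneq ab => ->; rewrite adj_irr.
  move: ab; rewrite orth_adj // => /set0Pn[z]; rewrite inE => /andP[zx _].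
  by apply/set0Pn; exists z.
have Lam_inj : injective Lam.
  move=> x y E; apply/eqP/negbNE/negP => xy; apply: (twinG x y); split; first exact/eqP.
  have half a b : a != b -> Lam a = Lam b -> cnbhd a \subset cnbhd b.
    move=> ab Eab; apply/subsetP => z; rewrite !inE => /orP[/eqP->|az].
      have ba : b != a by rewrite eq_sym.
      by rewrite (negPf ab) /= (orth_adj _ _ ba) Eab setIid Lam_neq0.
    have [//|zb /=] := eqVneq z b.
    have za : a != z by apply: contraTneq az => ->; rewrite adj_irr.
    have bz : b != z by rewrite eq_sym.
    by move: az; rewrite (orth_adj _ _ za) (orth_adj _ _ bz) Eab.
  by apply/eqP; rewrite eqEsubset !half // eq_sym.
(* A leaf of [T] has degree at most one in each subtree containing it, and these subtrees are
   paths. *)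
have Lam_le2 x : #|Lam x| <= 2.
  have [[[_ connS] _] degS] := treeS x.
  apply: leq_trans (path_ends connS degS).
  rewrite -(card_imset _ val_inj); apply: subset_leq_card; apply/subsetP => y.
  rewrite inE => /andP[ly yx]; apply/imsetP; exists (Sub y yx) => //.
  rewrite inE; move: ly; rewrite /leaf /degree => /eqP <-.
  rewrite -(card_imset _ val_inj); apply: subset_leq_card; apply/subsetP => z.
  by case/imsetP=> z'; rewrite !inE => /sub_edgeP/and3P[_ _] + -> .
pose L u v := Lam (f (le u v)).
have le_shares u v u' v' : adj u v -> adj u' v' -> le u v = le u' v' -> [set u; v] = [set u'; v'].
  by move=> uv uv' E; rewrite -leE // -[RHS]leE // E.
have shares_of_le u v u' v' : adj u v -> adj u' v' -> le u v = le u' v' -> shares u v u' v'.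
  move=> uv uv' /(le_shares _ _ _ _ uv uv') E.
  by rewrite sharesE E -sharesE shares_refl.
have adj_le u v u' v' : adj u v -> adj u' v' -> le u v != le u' v' ->
    adj (f (le u v)) (f (le u' v')) = shares u v u' v'.
  by move=> uv uv' ne; rewrite fadj /= /line_adj ne !leE // sharesE.
have [phi [g [fibre gP gshares]]] : exists phi g, @relabelling H T L phi g.
  apply: relabelling_exists => //.
  - by rewrite cardG.
  - by move=> u v; rewrite /L /le setUC.
  - by move=> u v _; apply: Lam_neq0.
  - by move=> u v _; apply: Lam_le2.
  - move=> u v u' v' uv uv'; have [E|ne] := eqVneq (le u v) (le u' v').
      by rewrite /L E setIid Lam_neq0 shares_of_le.
    by rewrite -adj_le // orth_adj // (inj_eq injf).
  - by move=> u v u' v' uv uv' /Lam_inj/injf; apply: le_shares.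
pose R u v := S (f (le (g u v).1 (g u v).2)).
have phiR u v : adj u v -> phi u \in sub_verts (R u v) /\ phi v \in sub_verts (R u v).
  by move=> /gP[_]; rewrite !inE => /andP[_ ?] /andP[_ ?].
exists T, phi, R; split=> //; split=> //.
- move=> u; have : exists2 v, adj u v & true.
    have [|v uv] := @has_neighbour H connH _ u; first by rewrite cardG.
    by exists v.
  by case=> v /gP[_ + _] _; rewrite inE => /andP[].
- move=> u v D uv Du nDv; have [uS vS] := phiR u v uv.
  have [[[_ connS] _] _] := treeS (f (le (g u v).1 (g u v).2)).
  have [a [b [ab Da nDb]]] := connect_cut (D := fun x => D (val x))
    (connS (exist _ (phi u) uS) (exist _ (phi v) vS)) Du nDv.
  by exists (val a), (val b).
- move=> u v x y uv xy nl; have /and3P[xS yS _] := sub_edgeP xy.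
  pose x' : R u v := exist _ x xS; pose y' : R u v := exist _ y yS.
  have nl' : ~~ leaf x' by apply: contra nl => /leafS.
  have yn : y' \in nbhd x' by rewrite inE.
  have: 0 < #|nbhd x' :\ y'|.
    by move: nl'; rewrite /leaf /degree (cardsD1 y') yn add1n eqSS -lt0n.
  case/card_gt0P=> z; rewrite !inE => /andP[zy xz].
  by exists (val z) => //; rewrite -[y]/(val y') val_eqE.
- move=> u v u' v' uv uv' meet; apply: gshares => //.
  have [auv _ _] := gP u v uv; have [auv' _ _] := gP u' v' uv'.
  have [E|ne] := eqVneq (le (g u v).1 (g u v).2) (le (g u' v').1 (g u' v').2).
    exact: shares_of_le.
  rewrite -adj_le //.
  have tf := orth _ _ (elimN eqP (introN eqP (contra_not (@injf _ _) (elimN eqP ne)))).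
  by case: meet => [meet|meet]; [apply/(tf 0 1) | apply/(tf 0 2)].
Qed.

Lemma tree_rep_subgraph (t : nat) (H T : sgraph) (phi : H -> T)
    (R : H -> H -> subgraph T) (K : subgraph H) :
  tree_rep t phi R ->
  tree_rep t (fun u : K => phi (val u)) (fun u v => R (val u) (val v)).
Proof.
have adjK (u v : K) : adj u v -> adj (val u) (val v) by case/sub_edgeP/and3P.
case=> lf fb cut thr meet; split=> // [x|u v D uv|u v x y /adjK|u v u' v' uv uv' m].
- apply: leq_trans (fb x); rewrite -(card_imset _ val_inj).
  by apply: subset_leq_card; apply/subsetP => y /imsetP[u]; rewrite !inE => + ->.
- exact: cut (adjK _ _ uv).
- exact: thr.
- by have := meet _ _ _ _ (adjK _ _ uv) (adjK _ _ uv') m; rewrite /shares !val_eqE.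
Qed.

Lemma orth_separation (h t : nat) (G H : sgraph) :
  3 <= h -> connected G -> twin_free G -> 4 <= #|G| -> connected H ->
  iso (line_graph H) G -> ORTH h 2 t G ->
  forall K : subgraph H, 2 <= #|K| ->
  exists X A B : {set K}, separation h (h.-1 ^ (t - 2)) X A B.
Proof.
move=> h3 cG twG G4 cH isoG orthG K K2.
have [T [phi [R [treeT degT rep]]]] := orth_tree_rep cG twG G4 cH isoG orthG.
have [K3|] := leqP 3 #|K|.
  exact: rep_separation treeT degT h3 (tree_rep_subgraph K rep) K3.
(* Two vertices may carry the same leaf, so that no edge of the tree separates them; they are split
   by hand. *)
move=> K3; have Kcard : #|K| = 2 by apply/eqP; rewrite eqn_leq K2 -ltnS K3.
have /card_gt0P[a _] : 0 < #|K| by rewrite Kcard.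
have c1 : #|[set~ a]| = 1 by rewrite cardsC1 Kcard.
exists [set a], [set a], [set~ a]; split.
- by rewrite setUCr.
- by rewrite setICr.
- by rewrite c1 cards1 Kcard; lia.
- by rewrite cards1 expn_gt0; lia.
- by move=> x y; rewrite setDv inE.
Qed.

(** * Rational bounds as inequalities of natural numbers *)

Section RationalBounds.
Import Order.TTheory GRing.Theory Num.Theory.
Local Open Scope ring_scope.

(** For [t < 2] the exponent is negative and the maximum is 1, which truncated subtraction gives as
    a zeroth power. *)
Lemma separator_boundE (h t k : nat) : (3 <= h)%N ->
  (k%:R <= Num.max 1 ((h%:R - 1) ^ (t%:Z - 2) : rat)) = (k <= h.-1 ^ (t - 2))%N.
Proof.
move=> h3; have h0 : (0 < h)%N by apply: ltn_trans h3.
have -> : h%:R - 1 = h.-1%:R :> rat by rewrite -subn1 natrB.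
have [t2|t2] := leqP 2 t.
  have -> : t%:Z - 2 = (t - 2)%N by rewrite -subzn.
  rewrite -exprnP -natrX (_ : Num.max _ _ = (h.-1 ^ (t - 2))%:R) ?ler_nat //.
  by apply/max_idPr; rewrite (ler_nat _ 1) expn_gt0; lia.
have h1 : 1 <= h.-1%:R :> rat by rewrite (ler_nat _ 1); lia.
rewrite (_ : (t - 2 = 0)%N) ?expn0; last lia.
rewrite (_ : Num.max _ _ = 1) ?(ler_nat _ _ 1) //; apply/max_idPl.
have -> : t%:Z - 2 = - (2 - t)%N%:Z by rewrite -subzn ?opprB // ltnW.
rewrite -exprnN invf_le1; first exact: exprn_ege1.
by apply: exprn_gt0; apply: lt_le_trans h1.
Qed.

Lemma balance_boundE (h n a b : nat) : (3 <= h)%N -> (a + b = n)%N ->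
  ((h%:R : rat)^-1 * n%:R <= a%:R <= ((h%:R : rat) - 1) / h%:R * n%:R) =
  (n <= h * a)%N && (n <= h * b)%N.
Proof.
move=> h3 abn; have h0 : 0 < h%:R :> rat by rewrite ltr0n; lia.
rewrite ler_pdivrMl // -natrM ler_nat; congr (_ && _).
rewrite mulrAC ler_pdivlMr // mulrBl mul1r lerBrDr -!natrM -natrD ler_nat.
by rewrite -abn !mulnDr [(a * h)%N]mulnC leq_add2l.
Qed.

Lemma balanced_separationP (h t : nat) (K : sgraph) (X A B : {set K}) :
  (3 <= h)%N ->
  balanced_separation h t X A B <-> separation h (h.-1 ^ (t - 2)) X A B.
Proof.
move=> h3; have cardAB : A :|: B = setT -> A :&: B = set0 -> (#|A| + #|B| = #|K|)%N.
  by move=> AB AB0; rewrite -cardsUI AB AB0 cards0 addn0 cardsT.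
split=> [[[AB AB0] bA _ cX sep]|[AB AB0 [bA bB] cX sep]].
  move: bA; rewrite (balance_boundE h3 (cardAB AB AB0)) => /andP[bA bB].
  by split=> //; rewrite -separator_boundE.
have E := cardAB AB AB0; split=> //.
- by rewrite (balance_boundE h3 E) bA bB.
- by rewrite addnC in E; rewrite (balance_boundE h3 E) bA bB.
- by rewrite separator_boundE.
Qed.

End RationalBounds.

(** * Bounded loops on the random access machine *)

(* A language of bounded loops: the store consists of [width] unbounded rows;
   row 0 holds scalars, which are assigned at constant indices only.  [HN] is
   the input size, which bounds every loop. *)
Inductive hexp :=
| HC of nat
| HN
| HV of nat & hexp
| HP of hexp & hexp
| HM of hexp & hexp.

Inductive cmd :=
| CSkip
| CSet of nat & hexp
| CArr of nat & hexp & hexp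
| CSeq of cmd & cmd
| CIf of hexp & cmd & cmd
| CFor of nat & cmd.

Definition store := nat -> nat -> nat.

Definition upd (s : store) (r i k : nat) : store :=
  fun r' i' => if (r' == r) && (i' == i) then k else s r' i'.

Section Semantics.
Variable n : nat.

Fixpoint hev (s : store) (e : hexp) : nat :=
  match e with
  | HC k => k
  | HN => n
  | HV r e => s r (hev s e)
  | HP e f => hev s e + hev s f
  | HM e f => hev s e - hev s f
  end.

(** A loop writes the round number into its counter instead of incrementing it. Both agree when the
    body leaves the counter alone, as [wf_cmd] demands. *)
Fixpoint sem (c : cmd) (s : store) : store :=
  match c with
  | CSkip => s
  | CSet k e => upd s 0 k (hev s e)
  | CArr r e f => upd s r.+1 (hev s e) (hev s f)
  | CSeq c d => sem d (sem c s)
  | CIf e c d => if hev s e != 0 then sem c s else sem d s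
  | CFor k c => iteri n (fun i s' => upd (sem c s') 0 k i.+1) (upd s 0 k 0)
  end.
End Semantics.

(** Syntactic frame conditions, which compute on concrete commands. *)
Fixpoint assigns (k : nat) (c : cmd) : bool :=
  match c with
  | CSkip | CArr _ _ _ => false
  | CSet k' _ => k == k'
  | CSeq c d | CIf _ c d => assigns k c || assigns k d
  | CFor k' c => (k == k') || assigns k c
  end.

Fixpoint writes (r : nat) (c : cmd) : bool :=
  match c with
  | CSkip => false
  | CSet _ _ => r == 0
  | CArr r' _ _ => r == r'.+1
  | CSeq c d | CIf _ c d => writes r c || writes r d
  | CFor k' c => (r == 0) || writes r c
  end.

Lemma sem_assigns n k c s : ~~ assigns k c -> sem n c s 0 k = s 0 k.
Proof.
elim: c s => //= [k' e|c IHc d IHd|e c IHc d IHd|k' c IHc] s.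
- by rewrite /upd eqxx => /negPf->.
- by rewrite negb_or => /andP[/IHc c0 /IHd d0]; rewrite d0 c0.
- by rewrite negb_or => /andP[/IHc c0 /IHd d0]; case: ifP.
- rewrite negb_or => /andP[/negPf kk /IHc c0].
  elim: {1}n => [|j IHj] /=; first by rewrite /upd eqxx kk.
  by rewrite {1}/upd eqxx kk /= c0.
Qed.

Lemma sem_writes n r i c s : ~~ writes r c -> sem n c s r i = s r i.
Proof.
elim: c s => //= [k' e|r' e f|c IHc d IHd|e c IHc d IHd|k' c IHc] s.
- by rewrite /upd => /negPf->.
- by rewrite /upd => /negPf->.
- by rewrite negb_or => /andP[/IHc c0 /IHd d0]; rewrite d0 c0.
- by rewrite negb_or => /andP[/IHc c0 /IHd d0]; case: ifP.
- rewrite negb_or => /andP[/negPf kk /IHc c0].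
  elim: {1}n => [|j IHj] /=; first by rewrite /upd kk.
  by rewrite {1}/upd kk /= c0.
Qed.

Lemma sem_for n k c s (I : nat -> store -> Prop) :
  ~~ assigns k c ->
  I 0 (upd s 0 k 0) ->
  (forall i s', i < n -> s' 0 k = i -> I i s' -> I i.+1 (upd (sem n c s') 0 k i.+1)) ->
  I n (sem n (CFor k c) s).
Proof.
move=> nk I0 IS /=.
set F := fun i s' => _.
have: forall j, j <= n -> I j (iteri j F (upd s 0 k 0)) /\ iteri j F (upd s 0 k 0) 0 k = j.
  elim=> [|j IHj] /= jn; first by rewrite {2}/upd !eqxx.
  have [Ij jk] := IHj (ltnW jn); split; first exact: IS.
  by rewrite /F /upd !eqxx.
by move/(_ n (leqnn n)) => [].
Qed.

(** * Compilation of bounded loops *)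

Definition width := 6.

Fixpoint times (k : nat) (e : expr) : expr :=
  if k is k'.+1 then Plus e (times k' e) else Const 0.

(** Cell 1 holds the base address. The rows are interleaved with period [width], so that each of
    them is unbounded. *)
Definition adr (r : nat) (e : expr) : expr :=
  Plus (Fetch (Const 1)) (Plus (Const r) (times width e)).

Fixpoint cexp (e : hexp) : expr :=
  match e with
  | HC k => Const k
  | HN => Fetch (Const 0)
  | HV r e => Fetch (adr r (cexp e))
  | HP e f => Plus (cexp e) (cexp f)
  | HM e f => Minus (cexp e) (cexp f)
  end.

Definition scalar (k : nat) : expr := adr 0 (Const k).
Definition loop_test (k : nat) : expr := Minus (Fetch (Const 0)) (Fetch (scalar k)).
Definition loop_incr (k : nat) : expr := Plus (Fetch (scalar k)) (Const 1).

Fixpoint compile (c : cmd) : prog :=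
  match c with
  | CSkip => Skip
  | CSet k e => Store (scalar k) (cexp e)
  | CArr r e f => Store (adr r.+1 (cexp e)) (cexp f)
  | CSeq c d => Then (compile c) (compile d)
  | CIf e c d => If (cexp e) (compile c) (compile d)
  | CFor k c => Then (Store (scalar k) (Const 0))
      (While (loop_test k) (Then (compile c) (Store (scalar k) (loop_incr k))))
  end.

Fixpoint wf_exp (e : hexp) : bool :=
  match e with
  | HC _ | HN => true
  | HV r e => (r < width) && wf_exp e
  | HP e f | HM e f => wf_exp e && wf_exp f
  end.

Fixpoint wf_cmd (c : cmd) : bool :=
  match c with
  | CSkip => true
  | CSet _ e => wf_exp e
  | CArr r e f => [&& r.+1 < width, wf_exp e & wf_exp f]
  | CSeq c d => wf_cmd c && wf_cmd d
  | CIf e c d => [&& wf_exp e, wf_cmd c & wf_cmd d]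
  | CFor k c => ~~ assigns k c && wf_cmd c
  end.

(** An upper bound in [n] alone: both branches of a conditional are charged. *)
Fixpoint time (n : nat) (c : cmd) : nat :=
  match c with
  | CSkip => 1
  | CSet k e => (cost (scalar k) + cost (cexp e)).+1
  | CArr r e f => (cost (adr r.+1 (cexp e)) + cost (cexp f)).+1
  | CSeq c d => time n c + time n d
  | CIf e c d => (cost (cexp e)).+1 + (time n c + time n d)
  | CFor k c => (cost (scalar k) + 1).+1 +
     (n * ((cost (loop_test k)).+1 + (time n c + (cost (scalar k) + cost (loop_incr k)).+1))
      + (cost (loop_test k)).+1)
  end.

Section PolynomialTime.
Local Open Scope ring_scope.
Import GRing.Theory.

(** Equality with a polynomial, so that sums and products need no monotonicity. *)
Definition poly_bounded (f : nat -> nat) : Prop :=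
  exists p : {poly nat}, forall n, p.[n] = f n.

Lemma poly_bounded_const k : poly_bounded (fun _ => k).
Proof. by exists k%:P => n; rewrite hornerC. Qed.

Lemma poly_bounded_id : poly_bounded (fun n => n).
Proof. by exists 'X => n; rewrite hornerX. Qed.

Lemma poly_bounded_add f g : poly_bounded f -> poly_bounded g ->
  poly_bounded (fun n => f n + g n)%N.
Proof. by move=> [p pE] [q qE]; exists (p + q) => n; rewrite hornerD pE qE. Qed.

Lemma poly_bounded_mul f g : poly_bounded f -> poly_bounded g ->
  poly_bounded (fun n => f n * g n)%N.
Proof. by move=> [p pE] [q qE]; exists (p * q) => n; rewrite hornerM pE qE. Qed.

End PolynomialTime.

Ltac poly_bound :=
  repeat first [ assumption | apply: poly_bounded_add | apply: poly_bounded_mul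
               | apply: poly_bounded_id | apply: poly_bounded_const ].

Lemma time_poly c : poly_bounded (fun n => time n c).
Proof. by elim: c => /= *; poly_bound. Qed.

(** The index of [I] counts the rounds still to come, so the invariant also yields termination. *)
Lemma run_while_count (e : expr) (P : prog) (I : nat -> memory -> Prop) (bnd : nat) :
  (forall j m, I j.+1 m -> eval m e != 0 /\
     exists T m', [/\ run P m T m', T <= bnd & I j m']) ->
  (forall m, I 0 m -> eval m e = 0) ->
  forall j m, I j m -> exists T m',
    [/\ run (While e P) m T m', T <= j * ((cost e).+1 + bnd) + (cost e).+1 & I 0 m'].
Proof.
move=> step stop; elim=> [|j IHj] m Im.
  by exists (cost e).+1, m; split=> //; apply: RunWhileFalse; apply: stop.
have [ne [T1 [m1 [r1 le1 I1]]]] := step j m Im.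
have [T2 [m2 [r2 le2 I2]]] := IHj m1 I1.
exists (cost e + T1 + T2).+1, m2; split=> //; first exact: RunWhileTrue r1 r2.
by rewrite mulSn; lia.
Qed.

Lemma eval_times m k e : eval m (times k e) = k * eval m e.
Proof. by elim: k => //= k ->; rewrite mulSn. Qed.

Section Compiler.
Variables n b : nat.

Definition represents (m : memory) (s : store) : Prop :=
  [/\ m 0 = n, m 1 = b, 1 < b
    & forall r i, r < width -> m (b + (r + width * i)) = s r i].

Lemma eval_adr m r e : m 1 = b -> eval m (adr r e) = b + (r + width * eval m e).
Proof.
by move=> m1; rewrite -[LHS]/(m 1 + (r + eval m (times width e))) eval_times m1.
Qed.

Lemma rep_base m s : represents m s -> m 1 = b.
Proof. by case. Qed.

Lemma eval_cexp m s e : represents m s -> wf_exp e -> eval m (cexp e) = hev n s e.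
Proof.
move=> ms; elim: e => // [|r e IHe|e IHe f IHf|e IHe f IHf].
- by case: ms.
- rewrite [wf_exp _]/= => /andP[rw we].
  rewrite -[eval m _]/(m (eval m (adr r (cexp e)))) (eval_adr _ _ (rep_base ms)) IHe //.
  by case: ms => _ _ _ ->.
- by rewrite /= => /andP[? ?]; rewrite IHe ?IHf.
- by rewrite /= => /andP[? ?]; rewrite IHe ?IHf.
Qed.

Lemma represents_upd m s r i k : represents m s -> r < width ->
  represents (update m (b + (r + width * i)) k) (upd s r i k).
Proof.
move=> [m0 m1 b1 rows] rw; split=> //; rewrite /update; try by rewrite ifN //; lia.
move=> r' i' rw'; rewrite /upd rows //; case: eqP => E.
  suff [-> ->] : r' = r /\ i' = i by rewrite !eqxx.
  by move: E rw rw'; rewrite /width; lia.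
by case: eqP => [Er|//]; case: eqP => [Ei|//]; case: E; rewrite Er Ei.
Qed.

Lemma run_store m s r e f : represents m s -> r < width -> exists2 m',
  run (Store (adr r e) f) m (cost (adr r e) + cost f).+1 m'
  & represents m' (upd s r (eval m e) (eval m f)).
Proof.
move=> ms rw; exists (update m (eval m (adr r e)) (eval m f)); first exact: RunStore.
by rewrite (eval_adr _ _ (rep_base ms)); apply: represents_upd.
Qed.

Lemma compileP c m s : wf_cmd c -> represents m s ->
  exists T m', [/\ run (compile c) m T m', T <= time n c & represents m' (sem n c s)].
Proof.
elim: c m s => [|k e|r e f|c IHc d IHd|e c IHc d IHd|k c IHc] m s wf ms.
- by exists 1, m; split=> //; apply: RunSkip.
- have [|m' rm' rep'] := run_store (r := 0) (Const k) (cexp e) ms; first by [].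
  exists (cost (scalar k) + cost (cexp e)).+1, m'; split=> //.
  by rewrite /= (eval_cexp ms) in rep'.
- case/and3P: wf => rw we wf.
  have [m' rm' rep'] := run_store (cexp e) (cexp f) ms rw.
  exists (cost (adr r.+1 (cexp e)) + cost (cexp f)).+1, m'; split=> //.
  by rewrite !(eval_cexp ms) in rep'.
- case/andP: wf => wc wd.
  have [T1 [m1 [r1 le1 rep1]]] := IHc m s wc ms.
  have [T2 [m2 [r2 le2 rep2]]] := IHd m1 _ wd rep1.
  exists (T1 + T2), m2; split=> //; first exact: RunThen r1 r2.
  exact: leq_add.
- case/and3P: wf => we wc wd /=; case: ifPn => E.
    have [T1 [m1 [r1 le1 rep1]]] := IHc m s wc ms.
    exists (cost (cexp e) + T1).+1, m1; split=> //; last by lia.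
    by apply: RunIfTrue => //; rewrite (eval_cexp ms).
  have [T1 [m1 [r1 le1 rep1]]] := IHd m s wd ms.
  exists (cost (cexp e) + T1).+1, m1; split=> //; last by lia.
  by apply: RunIfFalse => //; rewrite (eval_cexp ms) //; apply/eqP/negbNE.
- case/andP: wf => nk wc.
  have [//|m0 r0 rep0] := run_store (r := 0) (Const k) (Const 0) ms.
  pose F i s' := upd (sem n c s') 0 k i.+1.
  pose St j := iteri j F (upd s 0 k 0).
  have Stk j : St j 0 k = j.
    by case: j => [|j]; rewrite /St /= /F /upd !eqxx.
  have evk m' s' : represents m' s' -> eval m' (Fetch (scalar k)) = s' 0 k.
    by move=> ms'; rewrite -[Fetch _]/(cexp (HV 0 (HC k))) (eval_cexp ms').
  pose I j m' := j <= n /\ represents m' (St (n - j)).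
  have I0 : I n m0 by rewrite /I subnn.
  have [||T [m' [rw le [_ rep']]]] := run_while_count (e := loop_test k)
    (P := Then (compile c) (Store (scalar k) (loop_incr k)))
    (bnd := time n c + (cost (scalar k) + cost (loop_incr k)).+1) _ _ I0.
  + move=> j m' [jn rep']; split.
      rewrite -[eval _ _]/(m' 0 - eval m' (Fetch (scalar k))) (evk _ _ rep') Stk.
      by case: rep' => -> _ _ _; lia.
    have [T1 [m1 [r1 le1 rep1]]] := IHc m' _ wc rep'.
    have [//|m2 r2 rep2] := run_store (r := 0) (Const k) (loop_incr k) rep1.
    exists (T1 + (cost (scalar k) + cost (loop_incr k)).+1), m2.
    split; [exact: RunThen r1 r2 | by rewrite leq_add2r | split; first exact: ltnW].
    move: rep2; rewrite -[eval m1 (loop_incr k)]/(eval m1 (Fetch (scalar k)) + 1).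
    rewrite (evk _ _ rep1) sem_assigns // Stk addn1 -[eval _ (Const k)]/k.
    by rewrite (_ : n - j = (n - j.+1).+1) //; lia.
  + move=> m' [_ rep'].
    rewrite -[eval _ _]/(m' 0 - eval m' (Fetch (scalar k))) (evk _ _ rep') Stk subn0.
    by case: rep' => -> _ _ _; rewrite subnn.
  exists ((cost (scalar k) + 1).+1 + T), m'; split.
  + exact: RunThen r0 rw.
  + by rewrite leq_add2l.
  + by rewrite subn0 in rep'.
Qed.

End Compiler.

(** * Setting up the memory, reading the input and writing the output *)

Definition adj_row := 4.
Definition out_row := 5.

(* The input matrix fills the low cells, whose only known contents are the
   zeros on the diagonal.  The first of these, cell 1, receives the base
   address of the rows; the second, cell [n + 2], is the loop counter. *)
Definition base_counter : expr := Plus (Fetch (Const 0)) (Const 2).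

Definition init_body : prog :=
  Then (Store (Const 1) (Plus (Fetch (Const 1)) (Fetch (Const 0))))
       (Store base_counter (Minus (Fetch base_counter) (Const 1))).

Definition init_base : prog :=
  Then (Store base_counter (Plus (Fetch (Const 0)) (Const 3)))
       (While (Fetch base_counter) init_body).

(** Adding [n] repeatedly, [n + 3] times, produces the base address [n * n + 3 * n], beyond both the
    input, which ends at cell [n * n], and the [3 * n] output cells. The counter ends at zero, the
    value its cell had in the input. *)
Lemma init_baseP : exists2 f, poly_bounded f &
  forall n m, 1 < n -> m 0 = n -> m 1 = 0 -> m (n + 2) = 0 ->
  exists T m', [/\ run init_base m T m', T <= f n, m' 1 = n * (n + 3)
    & forall a, a != 1 -> m' a = m a].
Proof.
exists (fun n => 100 + (n + 3) * 100); first by poly_bound.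
move=> n m n1 m0 m1 mc.
pose I j (m' : memory) := [/\ j <= n + 3, m' (n + 2) = j, m' 1 = n * (n + 3 - j)
  & forall a, a != 1 -> a != n + 2 -> m' a = m a].
pose m2 := update m (n + 2) (n + 3).
have I0 : I (n + 3) m2.
  rewrite /I /m2 /update eqxx subnn muln0; split=> //; first by rewrite ifN //; lia.
  by move=> a _ /negPf->.
have [||T [m' [rT leT [_ mc' m1' same]]]] :=
    run_while_count (e := Fetch base_counter) (P := init_body) (bnd := 40) _ _ I0.
- move=> j m' [jn mc' m1' same].
  have m0' : m' 0 = n by rewrite same //; lia.
  split; first by rewrite /= m0' mc'.
  pose m3 := update m' 1 (m' 1 + n).
  exists ((cost (Const 1) + cost (Plus (Fetch (Const 1)) (Fetch (Const 0)))).+1 +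
     (cost base_counter + cost (Minus (Fetch base_counter) (Const 1))).+1),
   (update m3 (n + 2) (m3 (n + 2) - 1)); split=> //.
    apply: (RunThen (m2 := m3)).
      by have := RunStore (Const 1) (Plus (Fetch (Const 1)) (Fetch (Const 0))) m'; rewrite /= m0'.
    have := RunStore base_counter (Minus (Fetch base_counter) (Const 1)) m3.
    by rewrite /= (_ : m3 0 = n).
  have m3c : m3 (n + 2) = j.+1 by rewrite /m3 /update ifN //; lia.
  split.
  + by lia.
  + by rewrite /update eqxx m3c subn1.
  + rewrite /update ifN; last by lia.
    rewrite /m3 /update eqxx m1' -mulnSr; congr (n * _); lia.
  + by move=> a a1 an; rewrite /update (negPf an) /m3 /update (negPf a1) same.
- move=> m' [_ mc' _ same]; have m0' : m' 0 = n by rewrite same //; lia.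
  by rewrite /= m0' mc'.
exists ((cost base_counter + cost (Plus (Fetch (Const 0)) (Const 3))).+1 + T), m'.
split.
- apply: RunThen rT.
  by have := RunStore base_counter (Plus (Fetch (Const 0)) (Const 3)) m; rewrite /= m0.
- by move: leT => /=; lia.
- by rewrite m1' subn0.
- by move=> a a1; case: (eqVneq a (n + 2)) => [->|an]; [rewrite mc' mc | rewrite same].
Qed.

Definition counter := scalar 0.

Definition copy_in_body : prog :=
  Then (Store (adr adj_row (Fetch counter)) (Fetch (Plus (Fetch counter) (Const 1))))
       (Store counter (Plus (Fetch counter) (Const 1))).

Definition copy_loop (start : nat) (body : prog) : prog :=
  Then (Store counter (Const start))
       (While (Minus (Fetch (Const 1)) (Fetch counter)) body).

Lemma eval_counter b m : m 1 = b -> eval m counter = b.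
Proof. by move=> m1; rewrite (eval_adr _ _ m1) /= addn0. Qed.

Lemma run_store_at m a e x y : eval m a = x -> eval m e = y ->
  run (Store a e) m (cost a + cost e).+1 (update m x y).
Proof. by move=> <- <-; apply: RunStore. Qed.

Lemma copy_loopP start body (b bnd : nat) (m : memory) (J : nat -> memory -> Prop) :
  start <= b -> m 1 = b -> 1 < b ->
  J start (update m b start) ->
  (forall i m', i < b -> m' 1 = b -> m' b = i -> J i m' ->
     exists T m'', [/\ run body m' T m'', T <= bnd, m'' 1 = b, m'' b = i.+1 & J i.+1 m'']) ->
  exists T m', [/\ run (copy_loop start body) m T m', T <= 100 + b * (100 + bnd), m' 1 = b & J b m'].
Proof.
move=> sb m1 b1 Js step.
pose I j (m' : memory) := [/\ j <= b, m' 1 = b, m' b = b - j & J (b - j) m'].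
have I0 : I (b - start) (update m b start).
  split; first by lia.
  - by rewrite /update ifN //; lia.
  - by rewrite /update eqxx; lia.
  - by rewrite (_ : b - (b - start) = start) //; lia.
have ev m' : m' 1 = b -> eval m' (Minus (Fetch (Const 1)) (Fetch counter)) = b - m' b.
  by move=> m1'; rewrite -[LHS]/(m' 1 - m' (eval m' counter)) (eval_counter m1') m1'.
have [||T [m' [rT leT [_ m1' _ Jb]]]] :=
    run_while_count (e := Minus (Fetch (Const 1)) (Fetch counter)) (P := body) (bnd := bnd) _ _ I0.
- move=> j m' [jb m1' mb' Jj]; rewrite ev // mb'; split; first by lia.
  have ji : b - j.+1 < b by lia.
  have [T [m'' [rT leT m1'' mb'' J']]] := step _ _ ji m1' mb' Jj.
  exists T, m''; split=> //; have E : (b - j.+1).+1 = b - j by lia.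
  by split; rewrite -?E //; apply: ltnW.
- by move=> m' [_ m1' mb' _]; rewrite ev // mb'; lia.
exists ((cost counter + cost (Const start)).+1 + T), m'; split=> //.
- apply: RunThen rT; exact: (run_store_at (eval_counter m1) (erefl _)).
- apply: (leq_trans (leq_add (leqnn _) leT)).
  have : (b - start) * (20 + bnd) <= b * (20 + bnd) by rewrite leq_mul2r leq_subr orbT.
  rewrite !mulnDr /= => H; move: H; lia.
- by rewrite subn0 in Jb.
Qed.

Definition copy_in : prog := copy_loop 0 copy_in_body.

Lemma copy_inP (b : nat) (m : memory) : m 1 = b -> 1 < b ->
  exists T m', [/\ run copy_in m T m', T <= 100 + b * 300, m' 0 = m 0, m' 1 = b
    & forall i, i.+1 < b -> m' (b + (adj_row + width * i)) = m i.+1].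
Proof.
move=> m1 b1.
pose J i (m' : memory) := (forall a, a < b -> m' a = m a) /\
  forall j, j < i -> j.+1 < b -> m' (b + (adj_row + width * j)) = m j.+1.
have [|i m' ib m1' mb' [low hi]|T [m' [rT leT m1' [low hi]]]] :=
  @copy_loopP 0 copy_in_body b 200 m J isT m1 b1.
- by split=> // a ab; rewrite /update ifN //; lia.
- have ec : eval m' counter = b := eval_counter m1'.
  have ea : eval m' (adr adj_row (Fetch counter)) = b + (adj_row + width * i).
    by rewrite (eval_adr _ _ m1') -[eval m' (Fetch counter)]/(m' (eval m' counter)) ec mb'.
  have ef : eval m' (Fetch (Plus (Fetch counter) (Const 1))) = m' i.+1.
    by rewrite -[LHS]/(m' (m' (eval m' counter) + 1)) ec mb' addn1.
  pose m2 := update m' (b + (adj_row + width * i)) (m' i.+1).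
  have m21 : m2 1 = b by rewrite /m2 /update ifN //; lia.
  have m2b : m2 b = i by rewrite /m2 /update ifN // /adj_row; lia.
  have ec2 : eval m2 counter = b := eval_counter m21.
  have ei : eval m2 (Plus (Fetch counter) (Const 1)) = i.+1.
    by rewrite -[LHS]/(m2 (eval m2 counter) + 1) ec2 m2b addn1.
  eexists _, (update m2 b i.+1); split.
  + exact: RunThen (run_store_at ea ef) (run_store_at ec2 ei).
  + by [].
  + by rewrite /update ifN //; lia.
  + by rewrite /update eqxx.
  + split=> [a ab|j ji jb].
      rewrite /update ifN; last by lia.
      by rewrite /m2 /update ifN ?low //; lia.
    rewrite /update ifN; last by rewrite /adj_row; lia.
    rewrite /m2 /update; case: eqP => E; last by apply: hi => //; move: E ji; rewrite /width; lia.
    have Ej : j = i by move: E; rewrite /width; lia.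
    by rewrite -Ej low.
- exists T, m'; split=> //; first by rewrite low //; lia.
  by move=> i ib; apply: hi => //; apply: ltnW.
Qed.

Definition copy_out_body : prog :=
  Then (Store (Fetch counter) (Fetch (adr out_row (Fetch counter))))
       (Store counter (Plus (Fetch counter) (Const 1))).

(** Overwriting cell 1 would destroy the base address, so the first two cells are left to
    [last_cells]. *)
Definition copy_out : prog := copy_loop 2 copy_out_body.

Lemma copy_outP (b : nat) (m : memory) : m 1 = b -> 1 < b ->
  exists T m', [/\ run copy_out m T m', T <= 100 + b * 300, m' 1 = b,
    forall a, 1 < a -> a < b -> m' a = m (b + (out_row + width * a))
    & forall a, b < a -> m' a = m a].
Proof.
move=> m1 b1.
pose J i (m' : memory) := (forall a, 1 < a -> a < i -> m' a = m (b + (out_row + width * a)))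
  /\ forall a, b < a -> m' a = m a.
pose J' i m' := 1 < i /\ J i m'.
have [|i m' ib m1' mb' [i1 [low hi]]|T [m' [rT leT m1' [_ [low hi]]]]] :=
  @copy_loopP 2 copy_out_body b 200 m J' b1 m1 b1.
- split=> //; split=> a ab; first by lia.
  by rewrite /update ifN //; lia.
- have ec : eval m' counter = b := eval_counter m1'.
  have ea : eval m' (Fetch counter) = i by rewrite -[LHS]/(m' (eval m' counter)) ec.
  have ef : eval m' (Fetch (adr out_row (Fetch counter))) = m (b + (out_row + width * i)).
    rewrite -[LHS]/(m' (eval m' (adr out_row (Fetch counter)))) (eval_adr _ _ m1') ea.
    by rewrite hi // /out_row; lia.
  pose m2 := update m' i (m (b + (out_row + width * i))).
  have m21 : m2 1 = b by rewrite /m2 /update ifN //; lia.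
  have m2b : m2 b = i by rewrite /m2 /update ifN //; lia.
  have ec2 : eval m2 counter = b := eval_counter m21.
  have ei : eval m2 (Plus (Fetch counter) (Const 1)) = i.+1.
    by rewrite -[LHS]/(m2 (eval m2 counter) + 1) ec2 m2b addn1.
  eexists _, (update m2 b i.+1); split.
  + exact: RunThen (run_store_at ea ef) (run_store_at ec2 ei).
  + by [].
  + by rewrite /update ifN //; lia.
  + by rewrite /update eqxx.
  + split; first exact: ltnW.
    split=> a ab => [ai|]; last first.
      rewrite /update ifN; last by lia.
      by rewrite /m2 /update ifN ?hi //; lia.
    rewrite /update ifN; last by lia.
    rewrite /m2 /update; case: eqP => [->//|E]; apply: low => //; lia.
- by exists T, m'.
Qed.

(** Once cell 1 is overwritten the output row is out of reach. The value meant for cell 0 is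
    therefore tested beforehand and remembered by the branch; only whether it is zero matters. *)
Definition last_cells : prog :=
  let out0 := Fetch (adr out_row (Const 0)) in
  let out1 := Fetch (adr out_row (Const 1)) in
  If out0 (Then (Store (Const 1) out1) (Store (Const 0) (Const 1)))
          (Then (Store (Const 1) out1) (Store (Const 0) (Const 0))).

Lemma last_cellsP (b : nat) (m : memory) : m 1 = b -> 1 < b ->
  exists T m', [/\ run last_cells m T m', T <= 200,
    (m' 0 != 0) = (m (b + (out_row + width * 0)) != 0),
    m' 1 = m (b + (out_row + width * 1))
    & forall a, 1 < a -> m' a = m a].
Proof.
move=> m1 b1.
have e0 : eval m (Fetch (adr out_row (Const 0))) = m (b + (out_row + width * 0)).
  by rewrite -[LHS]/(m (eval m (adr out_row (Const 0)))) (eval_adr _ _ m1).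
have e1 : eval m (Fetch (adr out_row (Const 1))) = m (b + (out_row + width * 1)).
  by rewrite -[LHS]/(m (eval m (adr out_row (Const 1)))) (eval_adr _ _ m1).
pose m2 := update m 1 (m (b + (out_row + width * 1))).
have [E|ne] := eqVneq (m (b + (out_row + width * 0))) 0.
  eexists _, (update m2 0 0); split; [ apply: RunIfFalse; [by rewrite e0 | ] | ..].
  - apply: RunThen (@run_store_at m (Const 1) _ 1 _ (erefl _) e1) _.
    exact: (@run_store_at m2 (Const 0) (Const 0) 0 0).
  - by [].
  - by rewrite ?E.
  - by [].
  - by case=> [|[]].
eexists _, (update m2 0 1); split; [ apply: RunIfTrue; [by rewrite e0 | ] | ..].
- apply: RunThen (@run_store_at m (Const 1) _ 1 _ (erefl _) e1) _.
  exact: (@run_store_at m2 (Const 0) (Const 1) 0 1).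
- by [].
- by rewrite ?ne.
- by [].
- by case=> [|[]].
Qed.

Definition whole_program (c : cmd) : prog :=
  Then init_base (Then copy_in (Then (compile c) (Then copy_out last_cells))).

Lemma whole_programP (c : cmd) : wf_cmd c -> exists2 f, poly_bounded f &
  forall n m, 1 < n -> m 0 = n -> m 1 = 0 -> m (n + 2) = 0 ->
  exists T m' s, [/\ run (whole_program c) m T m', T <= f n,
    forall i, 0 < i < n * n -> s adj_row i = m i.+1
    & forall a, a < 3 * n -> (m' a != 0) = (sem n c s out_row a != 0)].
Proof.
move=> wf; have [f fP base] := init_baseP; have tP := time_poly c.
exists (fun n => f n + (1000 + (n * (n + 3)) * 1000 + time n c)); first by poly_bound.
move=> n m n1 m0 m1 mc; set b := n * (n + 3).
have bn : n * n + 3 * n = b by rewrite /b mulnDr [n * 3]mulnC.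
have n2 : 0 < n * n by rewrite muln_gt0; lia.
have b1 : 1 < b by lia.
have [T1 [p1 [r1 le1 p1b p1s]]] := base n m n1 m0 m1 mc.
have [T2 [p2 [r2 le2 p20 p21 p2adj]]] := copy_inP p1b b1.
pose s : store := fun r i => p2 (b + (r + width * i)).
have rep2 : represents n b p2 s by split=> //; rewrite p20 p1s.
have [T3 [p3 [r3 le3 rep3]]] := compileP wf rep2.
have [p30 p31 _ p3row] := rep3.
have [T4 [p4 [r4 le4 p41 p4low p4hi]]] := copy_outP p31 b1.
have [T5 [p5 [r5 le5 p50 p51 p5s]]] := last_cellsP p41 b1.
exists (T1 + (T2 + (T3 + (T4 + T5)))), p5, s; split.
- exact: RunThen r1 (RunThen r2 (RunThen r3 (RunThen r4 r5))).
- move: le1 le2 le3 le4 le5; rewrite -/b; lia.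
- move=> i /andP[i0 inn]; rewrite /s p2adj; last by lia.
  by rewrite p1s //; lia.
- have out a : p4 (b + (out_row + width * a)) = sem n c s out_row a.
    by rewrite p4hi ?p3row // /out_row; lia.
  case=> [_|[_|a an]]; first by rewrite p50 out.
    by rewrite p51 out.
  rewrite p5s // p4low //; last by lia.
  by rewrite p3row.
Qed.

(** * The search for a separator *)

Definition sc (k : nat) : hexp := HV 0 (HC k).

Fixpoint mulh (h : nat) (e : hexp) : hexp :=
  if h is h'.+1 then HP e (mulh h' e) else HC 0.

(* Rows: 1 is the separator [X], 2 the side [A], 3 the current component;
   [CArr r] writes row [r.+1].  Scalars: 0 is the current vertex, 1 to 3 are
   loop indices, 4 is the offset of the current matrix row, 5 and 6 are
   cardinalities and [7 + k] is the [k]-th element of the separator. *)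
Definition clear (r : nat) : cmd := CFor 2 (CArr r (sc 2) (HC 0)).

Definition tally (r k : nat) : cmd :=
  CSeq (CSet k (HC 0)) (CFor 2 (CSet k (HP (sc k) (HV r (sc 2))))).

(* For entries 0 and 1 the test is positive iff [i] is in the component, [ij]
   is an edge, and neither [i] nor [j] is in the separator. *)
Definition relax : cmd :=
  CIf (HM (HP (HV 3 (sc 2)) (HV adj_row (HP (sc 4) (sc 3))))
          (HP (HC 1) (HP (HV 1 (sc 2)) (HV 1 (sc 3)))))
      (CArr 2 (sc 3) (HC 1)) CSkip.

Definition relax_row : cmd := CSeq (CFor 3 relax) (CSet 4 (HP (sc 4) HN)).

Definition relax_all : cmd := CSeq (CSet 4 (HC 0)) (CFor 2 relax_row).

Definition component : cmd :=
  CSeq (clear 2) (CSeq (CArr 2 (sc 0) (HC 1)) (CFor 1 relax_all)).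

Definition merge : cmd := CFor 2 (CIf (HV 3 (sc 2)) (CArr 1 (sc 2) (HC 1)) CSkip).

(** Truncated subtraction acts as a comparison: [HM HN (mulh h e)] is nonzero exactly when
    [h * e < n]. Scalar 6 is the size of the side, scalar 5 that of the component. *)
Definition extend (h : nat) : cmd :=
  CIf (HM HN (mulh h (sc 6)))
    (CSeq (CIf (HM HN (mulh h (sc 5))) CSkip (clear 1)) merge) CSkip.

Definition vertex_step (h : nat) : cmd :=
  CSeq component (CSeq (tally 2 6) (CSeq (tally 3 5) (extend h))).

Fixpoint mark_separator (M : nat) : cmd :=
  if M is M'.+1 then CSeq (mark_separator M') (CArr 0 (sc (7 + M')) (HC 1))
  else clear 0.

Definition output : cmd :=
  CFor 2 (CSeq (CArr 4 (sc 2) (HV 1 (sc 2)))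
         (CSeq (CArr 4 (HP HN (sc 2)) (HV 2 (sc 2)))
               (CArr 4 (HP (HP HN HN) (sc 2)) (HM (HC 1) (HV 2 (sc 2)))))).

(** A failed trial leaves the output row alone and a successful one overwrites it completely, so the
    last success survives without a flag. *)
Definition try_separator (h M : nat) : cmd :=
  CSeq (mark_separator M) (CSeq (clear 1) (CSeq (CFor 0 (vertex_step h))
  (CSeq (tally 2 5)
  (CIf (HP (HM HN (mulh h (sc 5))) (HM HN (mulh h (HM HN (sc 5))))) CSkip output)))).

(** The nesting depth [M] is fixed by [h] and [t], so the [n ^ M] rounds are polynomial in [n]. *)
Fixpoint all_tuples (M : nat) (c : cmd) : cmd :=
  if M is M'.+1 then CFor (7 + M') (all_tuples M' c) else c.

(** The first command restores matrix entry 0, a diagonal zero whose cell was taken for the base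
    address before the matrix was copied. *)
Definition search (h M : nat) : cmd :=
  CSeq (CArr 3 (HC 0) (HC 0)) (all_tuples M (try_separator h M)).

Arguments sem : simpl never.
Arguments upd : simpl never.

Lemma assigns_mark k M' : assigns k (mark_separator M') = (k == 2).
Proof. by elim: M' => [|M' IH] /=; rewrite ?IH orbF. Qed.

Lemma writes_mark r M' : writes r (mark_separator M') = (r == 0) || (r == 1).
Proof. by elim: M' => [|M' IH] //=; rewrite IH -orbA orbb. Qed.

Lemma assigns_all_tuples k M' c :
  (forall k, ~~ assigns (7 + k) c) -> M' <= k -> ~~ assigns (7 + k) (all_tuples M' c).
Proof.
move=> nc; elim: M' => [|M' IH] Mk; first exact: nc.
by rewrite /= negb_or IH ?andbT; lia.
Qed.

(** * Correctness of the search *)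

Section Correctness.
Variable n : nat.
Implicit Types (s : store) (c d : cmd) (p q : pred nat).

Lemma sem_skip s : sem n CSkip s = s. Proof. by []. Qed.
Lemma sem_seq c d s : sem n (CSeq c d) s = sem n d (sem n c s). Proof. by []. Qed.
Lemma sem_set k e s : sem n (CSet k e) s = upd s 0 k (hev n s e). Proof. by []. Qed.
Lemma sem_arr r e f s : sem n (CArr r e f) s = upd s r.+1 (hev n s e) (hev n s f).
Proof. by []. Qed.
Lemma sem_if e c d s : sem n (CIf e c d) s = if hev n s e != 0 then sem n c s else sem n d s.
Proof. by []. Qed.

Lemma hev_mulh s h e : hev n s (mulh h e) = h * hev n s e.
Proof. by elim: h => //= h ->; rewrite mulSn. Qed.

Definition row_is s r p := forall i, i < n -> s r i = p i.

Definition cardn p := #|[set i : 'I_n | p i]|.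

Lemma cardn_sum s r p : row_is s r p -> \sum_(0 <= i < n) s r i = cardn p.
Proof.
move=> sp; rewrite big_mkord /cardn cardsE -sum1_card [RHS]big_mkcond /=.
by apply: eq_bigr => i _; rewrite sp // unfold_in; case: (p i).
Qed.

Lemma cardn_le p : cardn p <= n.
Proof. by rewrite -[X in _ <= X](card_ord n) max_card. Qed.

Lemma clearP r s i : i < n -> sem n (clear r) s r.+1 i = 0.
Proof.
move: i; apply: (@sem_for n 2 _ s (fun j s' => forall i, i < j -> s' r.+1 i = 0)) => //.
move=> j s' jn s'j IH i; rewrite ltnS sem_arr /= s'j {1}/upd /= {1}/upd eqxx /=.
by rewrite leq_eqVlt; case: eqP => //= _; apply: IH.
Qed.

Lemma tallyP r k s : k != 2 -> sem n (tally r.+1 k) s 0 k = \sum_(0 <= i < n) s r.+1 i.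
Proof.
move=> k2; rewrite /tally sem_seq sem_set /=.
set s0 := upd _ _ _ _.
suff [] : sem n (CFor 2 (CSet k (HP (sc k) (HV r.+1 (sc 2))))) s0 0 k = \sum_(0 <= i < n) s r.+1 i
    /\ (forall i, sem n (CFor 2 (CSet k (HP (sc k) (HV r.+1 (sc 2))))) s0 r.+1 i = s r.+1 i) by [].
apply: (@sem_for n 2 _ s0 (fun j s' => s' 0 k = \sum_(0 <= i < j) s r.+1 i /\
   forall i, s' r.+1 i = s r.+1 i)).
- by rewrite -[assigns _ _]/(2 == k) eq_sym.
- by split=> //; rewrite /upd eqxx (negPf k2) /= /s0 /upd !eqxx big_geq.
- move=> j s' jn s'j [IH same]; rewrite sem_set /= s'j; split.
    by rewrite /upd eqxx (negPf k2) /= eqxx big_nat_recr //= IH same.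
  by move=> i; rewrite /upd /= same.
Qed.

Lemma cardn_proper p q j : (forall i, i < n -> p i -> q i) -> j < n -> q j -> ~~ p j ->
  cardn p < cardn q.
Proof.
move=> pq jn qj npj; apply: proper_card; apply/properP; split.
  by apply/subsetP => i; rewrite !inE; apply: pq.
by exists (Ordinal jn); rewrite inE.
Qed.

Section Components.
Variables (X : pred nat) (g : rel nat).

Definition free_edge i j := [&& g i j, ~~ X i & ~~ X j].

Definition environment s := row_is s 1 X /\
  forall i j, i < n -> j < n -> s adj_row (i * n + j) = g i j.

Definition closed_set p := forall i j, i < n -> j < n -> p i -> free_edge i j -> p j.

(** A vertex of [X] has no free edge, so it forms a component of its own. *)
Definition is_component v p :=
  [/\ p v, closed_set p & forall q, closed_set q -> q v -> forall i, i < n -> p i -> q i].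

Lemma environment_eq s s' : environment s ->
  (forall i, s' 1 i = s 1 i) -> (forall i, s' adj_row i = s adj_row i) -> environment s'.
Proof.
by case=> rX ra e1 ea; split=> [i|i j] lt => [|lt']; rewrite ?e1 ?ea; [apply: rX | apply: ra].
Qed.

Lemma environment_frame c s : environment s -> ~~ writes 1 c -> ~~ writes adj_row c ->
  environment (sem n c s).
Proof. by move=> env w1 wa; apply: environment_eq env _ _ => i; rewrite sem_writes. Qed.

Lemma closed_setP p : closed_set p \/ exists i j, [/\ i < n, j < n, p i, free_edge i j & ~~ p j].
Proof.
have [/forallP cl|] := boolP [forall i : 'I_n, [forall j : 'I_n, p i ==> free_edge i j ==> p j]].
  left=> i j ilt jlt pi eij.
  by have /forallP/(_ (Ordinal jlt)) := cl (Ordinal ilt); rewrite /= pi eij.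
case/forallPn=> i /forallPn[j]; rewrite !negb_imply => /and3P[pi eij pj].
by right; exists i, j.
Qed.

Lemma relax_rowP s p i : environment s -> i < n -> s 0 2 = i -> s 0 4 = i * n ->
  row_is s 3 p -> row_is (sem n relax_row s) 3 [pred j | p j || (p i && free_edge i j)].
Proof.
move=> [rX ra] ilt s2 s4 rp j jlt; rewrite /relax_row sem_seq sem_writes //.
pose I k s' := [/\ forall j, j < n -> s' 3 j = p j || [&& j < k, p i & free_edge i j],
  forall j, s' 1 j = s 1 j, forall j, s' adj_row j = s adj_row j, s' 0 2 = i & s' 0 4 = i * n].
suff [-> //] : I n (sem n (CFor 3 relax) s) by rewrite jlt.
apply: sem_for => //; first by split=> // k klt; rewrite /upd /= orbF rp.
move=> k s' kn s'3 [IH1 IH2 IH3 IH4 IH5].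
have hvt : hev n s' (HM (HP (HV 3 (sc 2)) (HV adj_row (HP (sc 4) (sc 3))))
    (HP (HC 1) (HP (HV 1 (sc 2)) (HV 1 (sc 3))))) != 0 = p i && free_edge i k.
  rewrite /= IH4 IH5 s'3 IH1 // !IH2 IH3 ra // !rX // /free_edge.
  by case: (p i); case: (X i); case: (X k); case: (g i k); rewrite //= ?andbF.
rewrite sem_if hvt sem_arr sem_skip /= s'3; case pe: (p i && free_edge i k);
  split=> [j' j'lt|j'|j'||]; rewrite /upd //= ltnS [j' <= k]leq_eqVlt.
- by case: eqP => [->|_] /=; [rewrite pe orbT | rewrite IH1].
- by rewrite IH1 //; case: eqP => [->|_] //=; rewrite ltnn /= pe.
Qed.

(** A sweep works in place and may already use vertices it has just added. Its result is therefore
    only bracketed: it contains [p] with all neighbours along free edges and stays within every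
    closed set around [p]. *)
Lemma relax_allP s p : environment s -> row_is s 3 p -> exists q,
  [/\ row_is (sem n relax_all s) 3 q,
      forall i, i < n -> p i -> q i,
      forall r, closed_set r -> (forall i, i < n -> p i -> r i) -> forall i, i < n -> q i -> r i
    & forall i j, i < n -> j < n -> p i -> free_edge i j -> q j].
Proof.
move=> env rp; rewrite /relax_all sem_seq sem_set /=.
pose I k s' := [/\ environment s', s' 0 4 = k * n & exists q,
  [/\ row_is s' 3 q, forall i, i < n -> p i -> q i,
      forall r, closed_set r -> (forall i, i < n -> p i -> r i) -> forall i, i < n -> q i -> r i
    & forall i j, i < k -> j < n -> p i -> free_edge i j -> q j]].
suff [_ _ //] : I n (sem n (CFor 2 relax_row) (upd s 0 4 0)).
apply: sem_for => //.
  split; [exact: environment_eq env _ _ | by rewrite /upd | exists p; split=> //].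
move=> k s' kn s'2 [env' s'4 [q [rq pq min_q ext]]].
split.
- apply: (environment_eq (s := sem n relax_row s')) => //.
  exact: environment_frame.
- rewrite {1}/upd /= /relax_row sem_seq sem_set /= !sem_assigns // s'4 mulSn addnC.
  by rewrite /upd.
exists [pred j | q j || (q k && free_edge k j)]; split.
- move=> i ilt; rewrite {1}/upd /=; exact: (relax_rowP env' kn s'2 s'4 rq).
- by move=> i ilt pi; rewrite inE pq.
- move=> r clr pr i ilt /= /orP[qi|/andP[qk eki]]; first exact: min_q qi.
  exact: (clr k i kn ilt (min_q r clr pr k kn qk) eki).
- move=> i j; rewrite ltnS leq_eqVlt => /orP[/eqP->|ik] jlt pi eij /=.
    by rewrite (pq k) //= eij orbT.
  by rewrite (ext i j).
Qed.

(** A sweep from a set that is not closed adds a vertex. After [k] sweeps the set is closed or has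
    more than [k] vertices, which is impossible for [k = n]. *)
Lemma componentP s v : environment s -> v < n -> s 0 0 = v -> exists2 p,
  row_is (sem n component s) 3 p & is_component v p.
Proof.
move=> env vlt s0; rewrite /component !sem_seq sem_arr /= sem_assigns // s0.
set s1 := upd _ _ _ _.
have env1 : environment s1.
  apply: (environment_eq (s := sem n (clear 2) s)) => //; exact: environment_frame.
have r1 : row_is s1 3 (pred1 v).
  move=> i ilt; rewrite /s1 /upd /=; case: eqP => //= _; exact: clearP.
pose I k s' := environment s' /\ exists p,
  [/\ row_is s' 3 p, p v, forall q, closed_set q -> q v -> forall i, i < n -> p i -> q i
    & closed_set p \/ k < cardn p].
suff [_ [p [rp pv min_p]]] : I n (sem n (CFor 1 relax_all) s1).
  case=> [cl|]; last by rewrite ltnNge cardn_le.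
  by exists p.
apply: sem_for => //.
  split; first exact: environment_eq env1 _ _.
  exists (pred1 v); split=> //=.
  - by move=> q _ qv i _ /eqP->.
  - by right; apply/card_gt0P; exists (Ordinal vlt); rewrite inE /=.
move=> k s' kn s'1 [env' [p [rp pv min_p cl]]].
have [q [rq pq min_q ext]] := relax_allP env' rp.
split.
  apply: (environment_eq (s := sem n relax_all s')) => //; exact: environment_frame.
exists q; split=> //.
- exact: pq.
- by move=> r clr rv; apply: min_q => // i ilt; apply: min_p.
have [clp|[i [j [ilt jlt pi eij npj]]]] := closed_setP p.
  have qp := min_q p clp (fun _ _ pi => pi).
  by left=> i j ilt jlt qi eij; apply: pq => //; apply: (clp i) => //; apply: qp.
right; have lt := cardn_proper pq jlt (ext i j ilt jlt pi eij) npj.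
case: cl => [clp|]; first by rewrite (clp i j) in npj.
by move=> kc; apply: leq_ltn_trans lt.
Qed.

Lemma mergeP s p q : row_is s 2 p -> row_is s 3 q ->
  row_is (sem n merge s) 2 [pred i | p i || q i].
Proof.
move=> rp rq i ilt.
pose I k s' := (forall j, j < n -> s' 2 j = p j || ((j < k) && q j)) /\
  forall j, s' 3 j = s 3 j.
suff [-> //] : I n (sem n merge s) by rewrite ilt.
apply: sem_for => //; first by split=> // j jlt; rewrite /upd /= orbF rp.
move=> k s' kn s'2 [IH2 IH3].
rewrite sem_if /= s'2 IH3 rq // sem_arr sem_skip /= s'2.
case qk: (q k); split=> [j jlt|j]; rewrite /upd /= ?IH3 // ltnS [j <= k]leq_eqVlt.
- by case: eqP => [->|_] /=; [rewrite qk orbT | rewrite IH2].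
- by rewrite IH2 //; case: eqP => [->|_] //=; rewrite ltnn /= qk.
Qed.

Variable h : nat.
Hypothesis h_ge3 : 3 <= h.
Hypothesis n_gt0 : 0 < n.

Definition small_components := forall v p, v < n -> is_component v p ->
  n <= h * (n - cardn p).

(** Closedness holds for every [X] and makes each output a genuine separation. If the components are
    small, the side is either already balanced or has absorbed all vertices visited so far. *)
Definition side_invariant v p := closed_set p /\ (small_components ->
  (n <= h * cardn p -> n <= h * (n - cardn p)) /\
  (n <= h * cardn p \/ forall i, i < v -> p i)).

Lemma cardn_union p q : cardn [pred i | p i || q i] <= cardn p + cardn q.
Proof.
apply: leq_trans (leq_card_setU _ _); apply: subset_leq_card.
by apply/subsetP => i; rewrite !inE.
Qed.

Lemma vertex_stepP s v p : environment s -> v < n -> s 0 0 = v -> row_is s 2 p ->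
  side_invariant v p -> exists2 q, row_is (sem n (vertex_step h) s) 2 q
  & side_invariant v.+1 q.
Proof.
move=> env vlt s0 rp [clp invp].
have [c rc compc] := componentP env vlt s0; have [cv clc min_c] := compc.
rewrite -[sem n _ s]/(sem n (extend h) (sem n (tally 3 5) (sem n (tally 2 6) (sem n component s)))).
set s1 := sem n component s; set s2 := sem n (tally 2 6) s1; set s3 := sem n (tally 3 5) s2.
have rp1 : row_is s1 2 p by move=> i ilt; rewrite /s1 sem_writes // rp.
have rp3 : row_is s3 2 p by move=> i ilt; rewrite /s3 sem_writes // /s2 sem_writes // rp1.
have rc3 : row_is s3 3 c by move=> i ilt; rewrite /s3 sem_writes // /s2 sem_writes //; apply: rc.
have s35 : s3 0 5 = cardn c.
  rewrite /s3 tallyP //; apply: cardn_sum => i ilt.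
  by rewrite /s2 sem_writes //; apply: rc.
have s36 : s3 0 6 = cardn p by rewrite /s3 sem_assigns // /s2 tallyP //; apply: cardn_sum.
have unch : n <= h * cardn p -> side_invariant v.+1 p.
  by move=> big; split=> // small; have [up _] := invp small; split=> //; left.
rewrite /extend sem_if /= hev_mulh /= s36 subn_eq0.
have [big|small_p] := leqP n (h * cardn p); first by exists p; [|exact: unch].
rewrite sem_seq sem_if /= hev_mulh /= s35 subn_eq0.
have [big|small_c] := leqP n (h * cardn c).
  exists [pred i | (pred0 : pred nat) i || c i].
    apply: mergeP => i ilt; first exact: clearP.
    by rewrite sem_writes // rc3.
  split=> [|small]; first exact: clc.
  split; last by left.
  by move=> _; apply: small vlt compc.
exists [pred i | p i || c i]; first exact: mergeP.
have le_u := cardn_union p c.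
split=> [i j ilt jlt /= /orP[pi|ci] eij|small].
- by rewrite (clp i j).
- by rewrite (clc i j) // orbT.
have [_ [|allp]] := invp small; first by rewrite leqNgt small_p.
split; last first.
  by right=> i; rewrite ltnS leq_eqVlt /= => /orP[/eqP->|/allp->]; rewrite ?cv ?orbT.
(* Two sets below [n / h] have a union below [2 n / h], and [h >= 3] leaves at least [n / h] for the
   complement. *)
move=> _; rewrite mulnBr.
have hu : h * cardn [pred i | p i || c i] <= h * cardn p + h * cardn c.
  by rewrite -mulnDr leq_mul2l le_u orbT.
have hn : 3 * n <= h * n by rewrite leq_mul2r h_ge3 orbT.
lia.
Qed.

End Components.

(** [P] is reached in the round of the tuple [a] and kept by every later round, while [J] holds
    throughout. Neither may depend on the loop counters. *)
Lemma all_tuplesP M (a : nat -> nat) c (J P : store -> Prop) :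
  (forall k, ~~ assigns (7 + k) c) ->
  (forall k, k < M -> a k < n) ->
  (forall k v s, J s -> J (upd s 0 (7 + k) v)) ->
  (forall k v s, P s -> P (upd s 0 (7 + k) v)) ->
  (forall s, J s -> J (sem n c s)) ->
  (forall s, J s -> P s -> P (sem n c s)) ->
  (forall s, J s -> (forall k, k < M -> s 0 (7 + k) = a k) -> P (sem n c s)) ->
  forall s, J s -> P (sem n (all_tuples M c) s).
Proof.
move=> nc an Ju Pu Jc Pc hit s Js.
have Jall M' s' : J s' -> J (sem n (all_tuples M' c) s').
  elim: M' s' => [|M' IH] s' Js'; first exact: Jc.
  apply: (sem_for (I := fun _ => J)) => /=; [exact: assigns_all_tuples | exact: Ju |].
  by move=> i s'' _ _ Js''; apply/Ju/IH.
have Pall M' s' : J s' -> P s' -> P (sem n (all_tuples M' c) s').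
  elim: M' s' => [|M' IH] s' Js' Ps'; first exact: Pc.
  suff [] : J (sem n (all_tuples M'.+1 c) s') /\ P (sem n (all_tuples M'.+1 c) s') by [].
  apply: (sem_for (I := fun _ s => J s /\ P s)) => /=.
  - exact: assigns_all_tuples.
  - by split; [apply: Ju | apply: Pu].
  - by move=> i s'' _ _ [Js'' Ps'']; split; [apply/Ju/Jall | apply/Pu/IH].
suff main M' s' : M' <= M -> J s' -> (forall k, M' <= k -> k < M -> s' 0 (7 + k) = a k) ->
    P (sem n (all_tuples M' c) s').
  by apply: main => // k; rewrite leqNgt => /negP.
elim: M' s' => [|M' IH] s' M'M Js' sa; first by apply: hit => // k kM; apply: sa.
pose I j s' := [/\ J s', forall k, M' < k -> k < M -> s' 0 (7 + k) = a k & a M' < j -> P s'].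
have [_ _] : I n (sem n (all_tuples M'.+1 c) s'); last by apply; apply: an.
apply: sem_for => [||j s'' jn s''M [Js'' s''a Ps'']] /=.
- exact: assigns_all_tuples.
- split=> [|k M'k kM|//]; first exact: Ju.
  by rewrite /upd eqxx /= ifN ?sa //; lia.
split.
- exact/Ju/Jall.
- move=> k M'k kM; rewrite /upd eqxx /= ifN; last by lia.
  by rewrite sem_assigns ?s''a //; apply: assigns_all_tuples => //; apply: ltnW.
rewrite ltnS leq_eqVlt => /orP[/eqP E|lt]; apply: Pu; last by apply: Pall => //; apply: Ps''.
apply: IH => //; first exact: ltnW.
move=> k; rewrite leq_eqVlt => /orP[/eqP<-|M'k] kM; first by rewrite s''M E.
exact: s''a.
Qed.

Variables (h M : nat) (g : rel nat).
Hypothesis h_ge3 : 3 <= h.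
Hypothesis n_gt0 : 0 < n.

Definition valid s := exists X p : pred nat,
  [/\ forall i, i < n -> [/\ s out_row i = X i, s out_row (n + i) = p i
        & s out_row (n + n + i) = ~~ p i],
      cardn X <= M, n <= h * cardn p, n <= h * (n - cardn p)
    & forall i j, i < n -> j < n -> p i -> ~~ p j -> g i j -> X i || X j].

Lemma valid_eq s s' : (forall i, s' out_row i = s out_row i) -> valid s -> valid s'.
Proof.
by move=> E [X [p [rows ? ? ? ?]]]; exists X, p; split=> // i /rows; rewrite !E.
Qed.

Definition has_matrix s := forall i j, i < n -> j < n -> s adj_row (i * n + j) = g i j.

Lemma mark_separatorP s M' : row_is (sem n (mark_separator M') s) 1
  [pred i | has (fun k => s 0 (7 + k) == i) (iota 0 M')].
Proof.
elim: M' => [|M' IH] i ilt; first exact: clearP.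
have E : iota 0 M'.+1 = iota 0 M' ++ [:: M'] by rewrite -addn1 iotaD.
rewrite inE E has_cat [has _ [:: M']]/= orbF.
rewrite [mark_separator _]/= sem_seq sem_arr [hev _ _ _]/= sem_assigns ?assigns_mark //.
rewrite /upd /= eq_sym; case: eqP => _ /=; first by rewrite orbT.
by rewrite orbF IH.
Qed.

Lemma cardn_marked s : cardn [pred i | has (fun k => s 0 (7 + k) == i) (iota 0 M)] <= M.
Proof.
rewrite /cardn cardE -(size_map val).
rewrite -[X in _ <= X](size_iota 0 M) -(size_map (fun k => s 0 (7 + k)) (iota 0 M)).
apply: uniq_leq_size; first by rewrite (map_inj_uniq val_inj) enum_uniq.
move=> x /mapP[i]; rewrite mem_enum !inE => /hasP[k kM /eqP ki] ->.
by apply/mapP; exists k.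
Qed.

Lemma outputP s X p : row_is s 1 X -> row_is s 2 p -> forall i, i < n ->
  let s' := sem n output s in
  [/\ s' out_row i = X i, s' out_row (n + i) = p i & s' out_row (n + n + i) = ~~ p i].
Proof.
move=> rX rp i ilt s1; rewrite {}/s1.
pose I k s' := [/\ forall j, j < k -> [/\ s' out_row j = X j, s' out_row (n + j) = p j
    & s' out_row (n + n + j) = ~~ p j], forall j, s' 1 j = s 1 j & forall j, s' 2 j = s 2 j].
suff [out _ _] : I n (sem n output s) by apply: out.
apply: sem_for => [//|//|k s' kn s'2 [IHo IH1 IH2]].
rewrite !sem_seq !sem_arr /=; split=> [j jk|j|j]; rewrite /upd //= !s'2.
have jn : j < n by apply: leq_ltn_trans kn.
rewrite IH1 !IH2 rX ?rp //.
case: (eqVneq j k) => [->|ne].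
  rewrite !eqxx; do ![rewrite ifN; last by lia].
  by split=> //; case: (p k).
have jk' : j < k by rewrite ltn_neqAle ne.
by do ![rewrite ifN; last by lia]; apply: IHo.
Qed.

Lemma try_separatorP s : has_matrix s ->
  let X := [pred i | has (fun k => s 0 (7 + k) == i) (iota 0 M)] in
  valid s \/ small_components X g h -> valid (sem n (try_separator h M) s).
Proof.
move=> mat X hyp.
rewrite -[sem n _ s]/(sem n (CIf (HP (HM HN (mulh h (sc 5))) (HM HN (mulh h (HM HN (sc 5)))))
  CSkip output) (sem n (tally 2 5) (sem n (CFor 0 (vertex_step h))
  (sem n (clear 1) (sem n (mark_separator M) s))))).
set s1 := sem n (mark_separator M) s; set s2 := sem n (clear 1) s1.
set s3 := sem n (CFor 0 _) s2; set s4 := sem n (tally 2 5) s3.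
have env1 : environment X g s1.
  split; first exact: mark_separatorP.
  by move=> i j ilt jlt; rewrite /s1 sem_writes ?writes_mark ?mat.
have env2 : environment X g s2 by apply: environment_frame.
have [env3 [p rp [clp invp]]] : environment X g s3 /\
    exists2 p, row_is s3 2 p & side_invariant X g h n p.
  apply: (sem_for (I := fun k s' => environment X g s' /\
    exists2 p, row_is s' 2 p & side_invariant X g h k p)) => //.
    split; first exact: environment_eq env2 _ _.
    exists pred0; first by move=> i ilt; rewrite /upd /=; apply: clearP.
    split=> // small; split=> [|]; last by right.
    rewrite /cardn (_ : [set _ | _] = set0) ?cards0 ?muln0; first by lia.
    by apply/setP => i; rewrite !inE.
  move=> k s' kn s'0 [env' [p rp invp]]; split.
    apply: (environment_eq (s := sem n (vertex_step h) s')) => //; exact: environment_frame.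
  by have [q rq invq] := vertex_stepP h_ge3 n_gt0 env' kn s'0 rp invp; exists q.
have rp4 : row_is s4 2 p by move=> i ilt; rewrite /s4 sem_writes // rp.
have env4 : environment X g s4 by apply: environment_frame.
have out4 i : s4 out_row i = s out_row i.
  by rewrite /s4 sem_writes // /s3 sem_writes // /s2 sem_writes // /s1 sem_writes ?writes_mark.
have s45 : s4 0 5 = cardn p by rewrite /s4 tallyP //; apply: cardn_sum.
rewrite sem_if /= !hev_mulh /= s45 addn_eq0 !subn_eq0.
case: andP => [[big1 big2]|nbal] /=.
  exists X, p; split=> //.
  - by apply: outputP => //; case: env4.
  - exact: cardn_marked.
  - move=> i j ilt jlt pi npj gij; apply/negbNE/negP; rewrite negb_or => /andP[Xi Xj].
    by case/negP: npj; apply: (clp i j) => //; rewrite /free_edge gij Xi Xj.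
apply: (valid_eq out4); case: hyp => // small.
have [up alt] := invp small.
(* A side that has absorbed all vertices meets this bound as well. *)
have big1 : n <= h * cardn p.
  case: alt => // allp; rewrite (_ : cardn p = n) ?leq_pmull //; first by lia.
  rewrite /cardn (_ : [set _ | _] = setT) ?cardsT ?card_ord //.
  by apply/setP => i; rewrite !inE allp.
by case: nbal; split=> //; apply: up.
Qed.

Lemma searchP (a : nat -> nat) s :
  (forall k, k < M -> a k < n) ->
  (forall X : pred nat, X =1 (fun i => has (fun k => a k == i) (iota 0 M)) ->
     small_components X g h) ->
  g 0 0 = false ->
  (forall i j, i < n -> j < n -> 0 < i * n + j -> s adj_row (i * n + j) = g i j) ->
  valid (sem n (search h M) s).
Proof.
move=> an small g00 mat; rewrite /search sem_seq sem_arr /=.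
have nc k : ~~ assigns (7 + k) (try_separator h M) by rewrite /= assigns_mark.
apply: (all_tuplesP (a := a) (J := has_matrix)) => //.
- by move=> s' mat' i j ilt jlt; rewrite sem_writes ?mat' //= writes_mark.
- by move=> s' mat' val; apply: try_separatorP => //; left.
- move=> s' mat' sa; apply: try_separatorP => //; right; apply: small => i /=.
  by apply: eq_in_has => k; rewrite mem_iota => /andP[_ kM]; rewrite sa.
- move=> i j ilt jlt; rewrite /upd /=; case: eqP => [E|ne]; last by rewrite mat //; lia.
  have [-> ->] : i = 0 /\ j = 0 by move: E => /eqP; rewrite addn_eq0 muln_eq0; lia.
  by rewrite g00.
Qed.

End Correctness.

(** * Graphs with numbered vertices *)

Lemma wf_search h M : wf_cmd (search h M).
Proof.
have wf_mul k e : wf_exp (mulh k e) = (k == 0) || wf_exp e.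
  by elim: k => //= k ->; case: k => [|k]; rewrite ?andbT ?andbb.
have wf_mark : wf_cmd (mark_separator M) by elim: M => //= M' ->.
have wf_try : wf_cmd (try_separator h M).
  by rewrite /= wf_mark !wf_mul !orbT.
have nc k : ~~ assigns (7 + k) (try_separator h M) by rewrite /= assigns_mark.
rewrite -[wf_cmd _]/(wf_cmd (all_tuples M (try_separator h M))).
elim: {1}M => [|M' IH]; first exact: wf_try.
by rewrite /= IH andbT; apply: assigns_all_tuples.
Qed.

Section Numbering.
Variables (K : sgraph) (lab : 'I_#|K| -> K).
Hypothesis lab_bij : bijective lab.
Let n := #|K|.

Definition numbered (S : {set K}) : pred nat :=
  fun i => if insub i is Some i' then lab i' \in S else false.

Definition numbered_adj : rel nat := fun i j =>
  if (insub i, insub j) is (Some i', Some j') then adj (lab i') (lab j') else false.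

Lemma numberedE (S : {set K}) (i : 'I_n) : numbered S i = (lab i \in S).
Proof. by rewrite /numbered valK. Qed.

Lemma numbered_adjE (i j : 'I_n) : numbered_adj i j = adj (lab i) (lab j).
Proof. by rewrite /numbered_adj !valK. Qed.

Lemma mem_read_set m k (i : 'I_n) :
  (lab i \in read_set lab m k) = (m (k * n + i) != 0).
Proof.
apply/imsetP/idP => [[j]|mi]; last by exists i; rewrite ?inE.
by rewrite inE => mj /(bij_inj lab_bij)->.
Qed.

Lemma card_numbered (S : {set K}) (p : pred nat) :
  (forall i : 'I_n, (lab i \in S) = p i) -> cardn n p = #|S|.
Proof.
move=> Sp; rewrite /cardn -(card_imset _ (bij_inj lab_bij)); apply: eq_card => x.
have [f labK fK] := lab_bij; rewrite -(fK x) Sp.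
by rewrite mem_imset ?inE //; apply: bij_inj.
Qed.

(** A component avoiding [Y], which contains [X], stays within [A] or within [B], and each of them
    leaves at least [n / h] vertices outside. A component at a vertex of [Y] is a singleton. *)
Lemma separation_small h M (X A B : {set K}) : 3 <= h -> 2 <= n ->
  separation h M X A B -> exists2 a : nat -> nat,
  forall k, k < M -> a k < n &
  forall Y : pred nat, Y =1 (fun i => has (fun k => a k == i) (iota 0 M)) ->
    small_components n Y numbered_adj h.
Proof.
move=> h3 n2 [AB AB0 [bA bB] XM sep]; have [f labK fK] := lab_bij.
have n0 : 0 < n by apply: ltnW.
(* The default 0 pads the tuple when [X] has fewer than [M] elements, so [Y] may be larger than
   [X]. *)
exists (fun k => nth 0 [seq val (f x) | x <- enum X] k) => [k _|Y YE v p vlt].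
  have [lt|ge] := ltnP k (size [seq val (f x) | x <- enum X]); last by rewrite nth_default.
  by have /mapP[x _ ->] := mem_nth 0 lt; apply: ltn_ord.
have XY (i : 'I_n) : lab i \in X -> Y i.
  move=> iX; rewrite YE; apply/hasP; exists (index (lab i) (enum X)).
    by rewrite mem_iota /= add0n (leq_trans _ XM) // cardE index_mem mem_enum.
  by rewrite (nth_map (lab i)) ?index_mem ?mem_enum // nth_index ?mem_enum // labK.
case=> pv clp min_p.
have cardAB : #|A| + #|B| = n by rewrite -cardsUI AB AB0 cards0 addn0 cardsT.
have [Yv|nYv] := boolP (Y v).
  have: cardn n p <= 1.
    apply/card_le1_eqP => i j; rewrite !inE => pi pj; apply/val_inj.
    have cl1 : closed_set n Y numbered_adj (pred1 v).
      by move=> k l _ _ /eqP->; rewrite /free_edge Yv andbF.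
    have single (k : 'I_n) : p k -> val k = v.
      by move=> pk; apply/eqP; apply: (min_p (pred1 v)) => //=.
    by rewrite (single i pi) (single j pj).
  move=> c1; apply: (@leq_trans (3 * (n - cardn n p))); first by lia.
  by rewrite leq_mul2r h3 orbT.
have small (S : {set K}) : (forall x y, x \in S -> y \notin S -> x \notin X -> y \notin X -> ~ adj x y) ->
    n <= h * (n - #|S|) -> lab (Ordinal vlt) \in S -> n <= h * (n - cardn n p).
  move=> sepS bS vS; apply: leq_trans bS _; rewrite leq_mul2l; apply/orP; right.
  apply: leq_sub2l; rewrite -(card_numbered (fun i => esym (numberedE S i))).
  apply: subset_leq_card; apply/subsetP => i; rewrite !inE => pi.
  apply: (min_p (numbered S)) pi => //; last by rewrite (numberedE S (Ordinal vlt)).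
  move=> k l klt llt; rewrite (numberedE S (Ordinal klt)) (numberedE S (Ordinal llt)) => kS.
  case/and3P; rewrite (numbered_adjE (Ordinal klt) (Ordinal llt)) => akl nYk nYl.
  apply/negbNE/negP => lS; apply: (sepS _ _ kS lS) => //.
    by apply: contra nYk => /XY.
  by apply: contra nYl => /XY.
have inAB x : (x \in A) || (x \in B) by have := in_setT x; rewrite -AB inE.
case/orP: (inAB (lab (Ordinal vlt))) => [vA|vB].
  apply: (small A) => //.
    move=> x y xA yA xX yX; apply: sep; rewrite !inE ?xX ?yX //.
    by have := inAB y; rewrite (negPf yA).
  by rewrite (_ : n - #|A| = #|B|) //; lia.
apply: (small B) => //.
  move=> x y xB yB xX yX; rewrite adj_sym; apply: sep; rewrite !inE ?xX ?yX //.
  by have := inAB y; rewrite (negPf yB) orbF.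
by rewrite (_ : n - #|B| = #|A|) //; lia.
Qed.

Lemma valid_separation h M s m : valid n h M numbered_adj s ->
  (forall a, a < 3 * n -> (m a != 0) = (s out_row a != 0)) ->
  separation h M (read_set lab m 0) (read_set lab m 1) (read_set lab m 2).
Proof.
case=> Y [p [rows YM bp bp' sep]] out; have [f labK fK] := lab_bij.
have rowsE (i : 'I_n) : [/\ (lab i \in read_set lab m 0) = Y i,
    (lab i \in read_set lab m 1) = p i & (lab i \in read_set lab m 2) = ~~ p i].
  have [r0 r1 r2] := rows i (ltn_ord i); have ilt := ltn_ord i.
  rewrite !mem_read_set mul0n add0n mul1n mul2n -addnn !out; try lia.
  by rewrite r0 r1 r2; case: (Y i); case: (p i).
have E0 (i : 'I_n) : (lab i \in read_set lab m 0) = Y i by case: (rowsE i).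
have E1 (i : 'I_n) : (lab i \in read_set lab m 1) = p i by case: (rowsE i).
have E2 (i : 'I_n) : (lab i \in read_set lab m 2) = ~~ p i by case: (rowsE i).
have BC : read_set lab m 2 = ~: read_set lab m 1.
  by apply/setP => x; rewrite -(fK x) inE E2 E1.
have c1 := card_numbered E1.
split.
- by rewrite BC setUCr.
- by rewrite BC setICr.
- by rewrite BC [#|~: _|]cardsCs setCK -c1.
- by rewrite -(card_numbered E0).
- move=> x y; rewrite -(fK x) -(fK y) !in_setD !E0 E1 E2 => /andP[Yx px] /andP[Yy py] axy.
  have := sep _ _ (ltn_ord (f x)) (ltn_ord (f y)) px py.
  by rewrite numbered_adjE axy (negPf Yx) (negPf Yy) => /(_ isT).
Qed.

Lemma encodes_search h M m : 3 <= h -> 2 <= n -> encodes lab m ->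
  (exists X A B : {set K}, separation h M X A B) ->
  forall s, (forall i, 0 < i < n * n -> s adj_row i = m i.+1) ->
  valid n h M numbered_adj (sem n (search h M) s).
Proof.
move=> h3 n2 [_ mat _] [X [A [B sepXAB]]] s sadj.
have [a an small] := separation_small h3 n2 sepXAB.
apply: (searchP h3 (ltnW n2) an small).
  by rewrite (numbered_adjE (Ordinal (ltnW n2)) (Ordinal (ltnW n2))) adj_irr.
move=> i j ilt jlt pos; rewrite sadj; last first.
  rewrite pos /=; apply: (@leq_trans (i * n + n)); first by rewrite ltn_add2l.
  by rewrite -mulSnr leq_mul2r ilt orbT.
by rewrite (mat (Ordinal ilt) (Ordinal jlt)) (numbered_adjE (Ordinal ilt) (Ordinal jlt)).
Qed.

End Numbering.

Theorem theorem4 (h t : nat) (h_ge3 : 3 <= h) (t_ge1 : 1 <= t) :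
  (forall G H : sgraph,
     connected G -> twin_free G -> 4 <= #|G| ->
     connected H -> iso (line_graph H) G -> ORTH h 2 t G ->
   forall H' : subgraph H, 2 <= #|H'| ->
   exists X A B : {set H'}, balanced_separation h t X A B)
  /\
  poly_time_find
    (fun K : sgraph =>
       exists (G H : sgraph) (H' : subgraph H),
         [/\ connected G /\ twin_free G /\ 4 <= #|G|,
             connected H /\ iso (line_graph H) G,
             ORTH h 2 t G,
             2 <= #|H'|
           & K = H'])
    (fun (K : sgraph) (X A B : {set K}) => balanced_separation h t X A B).
Proof.
split.
  move=> G H cG twG G4 cH isoG orthG H' H'2.
  have [X [A [B sep]]] := orth_separation h_ge3 cG twG G4 cH isoG orthG H'2.
  by exists X, A, B; apply/balanced_separationP.
pose M := h.-1 ^ (t - 2).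
have [f [p pE] progP] := whole_programP (wf_search h M).
exists (whole_program (search h M)), p.
move=> K [G [H [H' [[cG [twG G4]] [cH isoG] orthG H'2 ->]]]] lab lab_bij m enc.
have sepH' := orth_separation h_ge3 cG twG G4 cH isoG orthG H'2.
have [m0 mat _] := enc.
(* The first two diagonal entries are the cells 1 and [n + 2] that the set-up of the memory expects
   to be zero. *)
pose o0 := Ordinal (ltnW H'2 : 0 < #|H'|); pose o1 := Ordinal H'2.
have m1 : m 1 = 0 by have := mat o0 o0; rewrite adj_irr.
have m2 : m (#|H'| + 2) = 0.
  by have := mat o1 o1; rewrite adj_irr /= mul1n -addnS.
have [T [m' [s [rT leT sadj out]]]] := progP _ m H'2 m0 m1 m2.
exists T, m'; split=> //; first by rewrite pE.
apply/balanced_separationP => //; apply: (valid_separation lab_bij _ out).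
exact: (encodes_search lab_bij h_ge3 H'2 enc sepH' sadj).
Qed.
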